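(* Let $n\ge 3$ and let $p$ be an odd prime such that $p\ge n-2$ if $n$ is even and $p\ge 2n-4$ if $n$ is odd. Let $k$ be a perfect field of characteristic $p$, $R_{p,n+1}=k[x_0,\dots,x_{n+1}]/(x_0^2+\cdots+x_{n+1}^2)$ and $\mathbf m=(x_0,\dots,x_{n+1})$. Then $$1+m_{n+1}+\frac{2n-4}{p}\;\ge\; e_{HK}(R_{p,n+1},\mathbf m)\;\ge\;1+m_{n+1}.$$
   Context: For a Noetherian ring $R$ of dimension $d$ containing a field of characteristic $p>0$ and an ideal $I$ of finite colength, the Hilbert–Kunz multiplicity is $e_{HK}(R,I)=\lim_{s\to\infty}\ell(R/I^{[q]})/q^{d}$ with $q=p^s$ and $I^{[q]}$ the ideal generated by $q$-th powers of elements of $I$. The numbers $m_j$ are defined by the Taylor expansion $\sec(x)+\tan(x)=1+\sum_{j\ge1} m_j x^j$ for $|x|<\pi/2$. *)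

(* Defs.v *)
From mathcomp Require Import all_boot all_algebra.
From mathcomp Require Import mpoly.
From Stdlib Require Import Reals.
From Coquelicot Require Import Coquelicot.

Set Implicit Arguments.
Unset Strict Implicit.
Unset Printing Implicit Defensive.

Import GRing.Theory.
Local Open Scope ring_scope.

Definition in_ideal_gen (P : comNzRingType) (S : P -> Prop) (g : P) : Prop :=
  exists l : seq (P * P), (forall a, a \in l -> S a.2) /\
                          g = \sum_(a <- l) a.1 * a.2.

Notation polyring k N := {mpoly k[N]}.

Definition max_ideal (k : fieldType) (N : nat) : polyring k N -> Prop :=
  in_ideal_gen (fun g => exists i : 'I_N, g = 'X_i).

Definition sumsq (k : fieldType) (N : nat) : polyring k N :=
  \sum_(i < N) 'X_i ^+ 2.

(* Preimage in k[x] of the Frobenius power m^[q] of the maximal ideal m of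
   R = k[x]/(f): the ideal generated by f and all q-th powers h^q, h in m. *)
Definition frob_pow_ideal (k : fieldType) (N : nat) (f : polyring k N) (q : nat)
  : polyring k N -> Prop :=
  in_ideal_gen (fun g => g = f \/ exists h, max_ideal h /\ g = h ^+ q).

Definition quot_dim (k : fieldType) (N : nat) (I : polyring k N -> Prop)
  (d : nat) : Prop :=
  exists b : 'I_d -> polyring k N,
    (forall g, exists c : 'I_d -> k, I (g - \sum_(i < d) c i *: b i)) /\
    (forall c : 'I_d -> k, I (\sum_(i < d) c i *: b i) -> forall i, c i = 0).

Definition perfect_of_char (k : fieldType) (p : nat) : Prop :=
  (p \in [pchar k]) /\ forall x : k, exists y : k, y ^+ p = x.

Local Close Scope ring_scope.
Local Open Scope R_scope.

Definition secplustan (x : R) : R := / cos x + tan x.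
Definition m_coef (j : nat) : R := Derive_n secplustan j 0 / INR (Stdlib.Arith.Factorial.fact j).

(* Main.v *)
(* Let N = n + 2, let q be a power of p, and let T be multiplication by
   f = x_1^2 + ... + x_N^2 on A_N(q) = k[x_1, ..., x_N]/(x_1^q, ..., x_N^q), so
   that the length at level q is D_N(q) = dim ker T.

   Frobenius identifies T^(r j) on A_N(q r), for r a power of p, with r^N copies
   of T^j on A_N(q).  Hence D_N(q)/q^(N-1) increases with q, and it converges as
   soon as it is bounded.

   Lower bound.  As T^q = 0 and T has degree 2, a string of T meets the degrees
   congruent to r mod 2q at most once, so D_N(q) is at least the number of
   monomials of degree r or r + 1 mod 2q.  For central r this number is fus N 1,
   where fus arises from a periodic step function by N window sums of length q.

   Upper bound.  Splitting off one variable, D_N(q) is the sum of the dimensions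
   of ker T^j on A_(N-1)(q) for j = (q-1)/2 and (q+1)/2; both are at most
   dim ker T^(q/p (p+1)/2), which by Frobenius is determined by level p.  At level
   p, K(j, l) = dim ker (T + y)^l on A[y]/y^j satisfies the discrete wave equation
   K(j-1, l) + K(j+1, l) = K(j, l-1) + K(j, l+1), and solving it shows that
   dim ker T^l on A_N(p) is exactly fus N l.

   Limit.  Up to its linear trend fus is antiperiodic with second difference
   -4 fus (N-2), so a discrete Taylor expansion at the centre gives a linear
   recurrence for the normalised central values.  It is a perturbation, of size
   1/q, of the recurrence for the m_j that expresses cos * (sec + tan) = 1 + sin. *)

Require Import Defs.
From Stdlib Require Import Reals.
From Coquelicot Require Import Coquelicot.
From HB Require Import structures.
From mathcomp Require Import all_boot all_order all_algebra.
From mathcomp Require Import mpoly Rstruct.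
From mathcomp Require Import zify ring lra.

Set Implicit Arguments.
Unset Strict Implicit.
Unset Printing Implicit Defensive.

Import Order.TTheory GRing.Theory Num.Theory.
Local Open Scope ring_scope.

(** * Kernels of nilpotent operators and tensor products *)

Section KernelDimension.
Variable k : fieldType.

(** Most equalities of dimensions below come from two such injections in opposite directions, which
    need not be mutually inverse. *)
Lemma dim_le_inj (V W : vectType k) (U : {vspace V}) (U' : {vspace W})
    (g : V -> W) :
  linear g -> (forall v, v \in U -> g v \in U') ->
  (forall v, v \in U -> g v = 0 -> v = 0) -> (\dim U <= \dim U')%N.
Proof.
move=> lin_g gU g_inj.
pose gl : {linear V -> W} :=
  HB.pack g (GRing.isLinear.Build _ _ _ _ g lin_g).
have glE v : linfun gl v = g v by rewrite lfunE.
have <- : \dim (linfun gl @: U) = \dim U.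
  apply: limg_dim_eq; apply/eqP; rewrite -subv0; apply/subvP => v.
  by rewrite memv_cap memv_ker glE memv0 => /andP[vU /eqP/(g_inj _ vU) ->].
by apply/dimvS/subvP => _ /memv_imgP[v vU ->]; rewrite glE gU.
Qed.

Definition kerp (V : vectType k) (T : 'End(V)) (j : nat) : {vspace V} :=
  lker (iter j (comp_lfun T) \1%VF).

Lemma iter_lfunE (V : vectType k) (T : 'End(V)) j v :
  iter j (comp_lfun T) \1%VF v = iter j T v.
Proof. by elim: j => [|j IH] /=; rewrite ?id_lfunE // comp_lfunE IH. Qed.

Lemma mem_kerp (V : vectType k) (T : 'End(V)) j v :
  (v \in kerp T j) = (iter j T v == 0).
Proof. by rewrite memv_ker iter_lfunE. Qed.

Lemma iter_lfun0 (V : vectType k) (T : 'End(V)) j : iter j T 0 = 0.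
Proof. by rewrite -iter_lfunE linear0. Qed.

Lemma iter_lfunP (V : vectType k) (T : 'End(V)) j c u v :
  iter j T (c *: u + v) = c *: iter j T u + iter j T v.
Proof. by rewrite -!iter_lfunE linearP. Qed.

Lemma kerp0 (V : vectType k) (T : 'End(V)) : \dim (kerp T 0) = 0%N.
Proof.
apply/eqP; rewrite dimv_eq0 -subv0; apply/subvP => v.
by rewrite mem_kerp memv0.
Qed.

Lemma kerp1 (V : vectType k) (T : 'End(V)) : kerp T 1 = lker T.
Proof. by apply/vspaceP => v; rewrite mem_kerp memv_ker. Qed.

Lemma kerp_le (V : vectType k) (T : 'End(V)) i j :
  (i <= j)%N -> (\dim (kerp T i) <= \dim (kerp T j))%N.
Proof.
move=> ij; apply/dimvS/subvP => v; rewrite !mem_kerp => /eqP Tv.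
by rewrite -(subnK ij) iterD Tv iter_lfun0.
Qed.

(** [T] sends the kernel of its (j+1)-st power into that of the j-th, losing at most its own
    kernel. *)
Lemma kerp_mul_le (V : vectType k) (T : 'End(V)) j :
  (\dim (kerp T j) <= j * \dim (lker T))%N.
Proof.
elim: j => [|j IH]; first by rewrite kerp0.
rewrite -(limg_ker_dim T) mulSn leq_add //; first exact/dimvS/capvSr.
apply: leq_trans IH; apply/dimvS/subvP => _ /memv_imgP[v + ->].
by rewrite !mem_kerp iterSr.
Qed.

(* [ext s T] is the operator T (x) 1 + 1 (x) S on V (x) k^J, where S maps the
   basis vector indexed by j to the sum of those indexed by the i with
   [s i = Some j]. *)
Definition ext_fun (V : vectType k) (J : finType) (s : J -> option J)
  (T : 'End(V)) (f : {ffun J -> V}) : {ffun J -> V} :=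
  [ffun i => T (f i) + oapp f 0 (s i)].

Lemma ext_fun_linear V J s T : linear (@ext_fun V J s T).
Proof.
move=> c f g; apply/ffunP => i; rewrite !ffunE linearP.
by case: (s i) => [j|] /=; rewrite ?ffunE ?scaler0 ?addr0 // scalerDr addrACA.
Qed.

HB.instance Definition _ V J s T :=
  GRing.isLinear.Build _ _ _ _ _ (@ext_fun_linear V J s T).

Definition ext (V : vectType k) (J : finType) (s : J -> option J)
  (T : 'End(V)) : 'End({ffun J -> V}) := linfun (ext_fun s T).

Lemma extE (V : vectType k) (J : finType) s (T : 'End(V)) f (i : J) :
  ext s T f i = T (f i) + oapp f 0 (s i).
Proof. by rewrite lfunE /= ffunE. Qed.

Definition intertwined (V W : vectType k) (T : 'End(V)) (S : 'End(W)) :=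
  exists (g : V -> W) (h : W -> V),
    [/\ linear g, linear h, cancel g h, cancel h g &
        forall v, g (T v) = S (g v)].

Lemma intertwined_sym (V W : vectType k) (T : 'End(V)) (S : 'End(W)) :
  intertwined T S -> intertwined S T.
Proof.
move=> [g [h [lg lh gK hK gT]]]; exists h, g; split=> // w.
by rewrite -{1}(hK w) -gT gK.
Qed.

Lemma linear_fun0 (V W : vectType k) (g : V -> W) : linear g -> g 0 = 0.
Proof.
by move=> lg; move: (lg (-1) 0 0); rewrite !scaleN1r oppr0 addr0 addNr.
Qed.

Lemma intertwined_kerp_le (V W : vectType k) (T : 'End(V)) (S : 'End(W)) j :
  intertwined T S -> (\dim (kerp T j) <= \dim (kerp S j))%N.
Proof.
move=> [g [h [lg lh gK hK gT]]].
have gTj v : g (iter j T v) = iter j S (g v).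
  by elim: j => //= j <-.
apply: (dim_le_inj lg) => v; rewrite ?mem_kerp => /eqP Tv.
  by rewrite -gTj Tv linear_fun0.
by move=> gv; rewrite -(gK v) gv linear_fun0.
Qed.

Lemma intertwined_kerp (V W : vectType k) (T : 'End(V)) (S : 'End(W)) j :
  intertwined T S -> \dim (kerp T j) = \dim (kerp S j).
Proof.
move=> TS; apply/eqP; rewrite eqn_leq !intertwined_kerp_le //.
exact: intertwined_sym.
Qed.

Lemma intertwined_lker (V W : vectType k) (T : 'End(V)) (S : 'End(W)) :
  intertwined T S -> \dim (lker T) = \dim (lker S).
Proof. by rewrite -!kerp1; apply: intertwined_kerp. Qed.

Lemma intertwined_ext (V W : vectType k) (T : 'End(V)) (S : 'End(W))
    (J : finType) (s : J -> option J) :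
  intertwined T S -> intertwined (ext s T) (ext s S).
Proof.
move=> [g [h [lg lh gK hK gT]]].
exists (fun f : {ffun J -> V} => [ffun i => g (f i)]),
  (fun f : {ffun J -> W} => [ffun i => h (f i)]).
split=> [c u v|c u v|f|f|f]; apply/ffunP => i; rewrite !(extE, ffunE) ?(lg, lh, gK, hK) //.
have gD x y : g (x + y) = g x + g y by rewrite -[x]scale1r lg !scale1r.
rewrite gD gT; congr (_ + _); case: (s i) => [j|] /=; rewrite ?ffunE //.
exact: linear_fun0.
Qed.

(** The two shifts act on different tensor factors, so the order of adjoining them is immaterial;
    the isomorphism transposes a doubly indexed family. Combined with [lker_ext_pr1], this trades a
    power of an operator for an extra nilpotent variable. *)
Lemma intertwined_swap (V : vectType k) (T : 'End(V)) (J J' : finType)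
    (s : J -> option J) (s' : J' -> option J') :
  intertwined (ext s (ext s' T)) (ext s' (ext s T)).
Proof.
exists (fun f : {ffun J -> {ffun J' -> V}} => [ffun i => [ffun j => f j i]]),
  (fun f : {ffun J' -> {ffun J -> V}} => [ffun i => [ffun j => f j i]]).
split=> [c u v|c u v|f|f|f]; apply/ffunP => i; apply/ffunP => j;
  rewrite ?(extE, ffunE) //=.
rewrite -!addrA; congr (_ + _).
case: (s j) => [j'|]; case: (s' i) => [i'|] /=; rewrite ?(extE, ffunE) //=;
 by rewrite ?addr0 ?add0r // addrC.
Qed.

Lemma lker_ext_None (V : vectType k) (T : 'End(V)) (J : finType) :
  \dim (lker (ext (fun _ : J => None) T)) = (#|J| * \dim (lker T))%N.
Proof.
have -> : (#|J| * \dim (lker T))%N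
          = \dim {: {ffun J -> subvs_of (lker T)}}.
  by rewrite dimvf.
apply/eqP; rewrite eqn_leq; apply/andP; split.
- apply: (@dim_le_inj _ _ _ _
    (fun f : {ffun J -> V} => [ffun i => vsproj (lker T) (f i)])) => [c u v|v _|v].
  + by apply/ffunP => i; rewrite !ffunE linearP.
  + exact: memvf.
  + rewrite memv_ker => /eqP Tv /ffunP v0; apply/ffunP => i.
    have Tvi: v i \in lker T.
      by move/ffunP: Tv => /(_ i); rewrite extE addr0 ffunE memv_ker => ->.
    by move: (v0 i); rewrite !ffunE => /(congr1 vsval); rewrite vsprojK.
- apply: (@dim_le_inj _ _ _ _ (fun f : {ffun J -> subvs_of (lker T)} => [ffun i => vsval (f i)]))
    => [c u v|v _|v _ /ffunP v0].
  + by apply/ffunP => i; rewrite !ffunE linearP.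
  + rewrite memv_ker; apply/eqP/ffunP => i; rewrite extE addr0 !ffunE.
    by apply/eqP; rewrite -memv_ker subvsP.
  + by apply/ffunP => i; apply: val_inj; move: (v0 i); rewrite !ffunE.
Qed.

(* Nilpotent Jordan blocks: [pr 1] is multiplication by x on k[x]/x^j and
   [pr 2] is multiplication by x^2. *)
Definition pr (c j : nat) (i : 'I_j) : option 'I_j :=
  if (c <= i)%N then Some (Ordinal (leq_ltn_trans (leq_subr c i) (ltn_ord i)))
  else None.

Lemma iter_opp (V : vectType k) (T : 'End(V)) j v :
  iter j (fun u => - T u) v = (-1) ^+ j *: iter j T v.
Proof.
elim: j => [|j IH] /=; first by rewrite scale1r.
by rewrite IH linearZ /= exprS mulN1r scaleNr.
Qed.

Lemma iter_opp_eq0 (V : vectType k) (T : 'End(V)) j v :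
  (iter j (fun u => - T u) v == 0) = (iter j T v == 0).
Proof. by rewrite iter_opp scaler_eq0 signr_eq0. Qed.

Definition at_nat (V : vectType k) j (f : {ffun 'I_j -> V}) n : V :=
  oapp f 0 (insub n).

Lemma at_natE (V : vectType k) j (f : {ffun 'I_j -> V}) (i : 'I_j) :
  at_nat f i = f i.
Proof. by rewrite /at_nat valK. Qed.

Lemma lker_ext_prP (V : vectType k) (T : 'End(V)) c j (f : {ffun 'I_j -> V}) :
  reflect (forall n, (n < j)%N ->
     - T (at_nat f n) = if (c <= n)%N then at_nat f (n - c) else 0)
    (f \in lker (ext (@pr c j) T)).
Proof.
rewrite memv_ker; apply: (iffP eqP) => [/ffunP Tf n lt_nj|Tf].
- move: (Tf (Ordinal lt_nj)); rewrite extE ffunE => /eqP.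
  rewrite addr_eq0 -at_natE /= => /eqP ->; rewrite opprK /pr /=.
  by case: ifP => //= _; rewrite -at_natE.
- apply/ffunP => i; rewrite extE ffunE; apply/eqP; rewrite addrC addr_eq0.
  rewrite -at_natE Tf // /pr; case: ifP => //= _; first by rewrite -at_natE.
Qed.

Lemma lker_ext_pr_iter (V : vectType k) (T : 'End(V)) c j
    (f : {ffun 'I_j -> V}) n m :
  f \in lker (ext (@pr c j) T) -> (n < j)%N ->
  iter m (fun u => - T u) (at_nat f n)
    = if (c * m <= n)%N then at_nat f (n - c * m) else 0.
Proof.
move=> /lker_ext_prP Tf lt_nj; elim: m => [|m IH].
  by rewrite muln0 subn0.
rewrite iterS IH; case: ifP => le_cm; last first.
  by rewrite linear0 oppr0 ifF //; nia.
rewrite Tf; last by lia.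
by rewrite mulnS -subnDA addnC; congr (if _ then _ else _); lia.
Qed.

(** If (T + x) f = 0 in V[x]/x^j, each coefficient is -T applied to the next one, so f is determined
    by its top coefficient v, and the only condition left is T^j v = 0. *)
Lemma lker_ext_pr1 (V : vectType k) (T : 'End(V)) j :
  \dim (lker (ext (@pr 1 j) T)) = \dim (kerp T j).
Proof.
case: j => [|j].
  rewrite kerp0; apply/eqP; rewrite dimv_eq0 -subv0; apply/subvP => v _.
  by rewrite memv0; apply/eqP/ffunP => -[].
apply/eqP; rewrite eqn_leq; apply/andP; split.
- apply: (@dim_le_inj _ _ _ _ (fun f : {ffun 'I_j.+1 -> V} => f ord_max))
    => [c u v|f fT|f fT f0].
  + by rewrite !ffunE.
  + rewrite mem_kerp -iter_opp_eq0 -at_natE (lker_ext_pr_iter _ fT) //=.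
    by rewrite ifF //; lia.
  + apply/ffunP => i; rewrite ffunE -at_natE.
    have := lker_ext_pr_iter (j - i) fT (ltnSn j).
    rewrite mul1n leq_subr subKn; last by have := ltn_ord i; lia.
    move=> <-; have -> : at_nat f j = 0 by rewrite -f0 -at_natE.
    by apply/eqP; rewrite iter_opp_eq0 iter_lfun0.
- apply: (@dim_le_inj _ _ _ _ (fun v =>
    [ffun i : 'I_j.+1 => iter (j - i) (fun u => - T u) v]))
    => [c u v|v Tv|v Tv /ffunP /(_ ord_max)].
  + apply/ffunP => i; rewrite !ffunE !iter_opp iter_lfunP scalerDr.
    by rewrite !scalerA mulrC.
  + rewrite memv_ker; apply/eqP/ffunP => i; rewrite extE !ffunE /pr.
    case: ifP => i0 /=; rewrite ?ffunE /=.
      have -> : (j - (i - 1) = (j - i).+1)%N by have := ltn_ord i; lia.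
      by rewrite iterS addrN.
    have -> : (j - i = j)%N by lia.
    apply/eqP; rewrite addr0 -oppr_eq0 -(iterS j (fun u => - T u)).
    by rewrite iter_opp_eq0 -mem_kerp.
  + by rewrite !ffunE subnn.
Qed.

(** The equation (T + x^2) f = 0 links coefficients of equal parity: the odd positions form a chain
    of length a with top 2a - 1, the even ones a chain of length a + 1 with top 2a, and each chain
    behaves as in [lker_ext_pr1]. *)
Lemma lker_ext_pr2 (V : vectType k) (T : 'End(V)) a : (0 < a)%N ->
  \dim (lker (ext (@pr 2 a.*2.+1) T))
    = (\dim (kerp T a) + \dim (kerp T a.+1))%N.
Proof.
move=> a0; pose W : vectType k := (subvs_of (kerp T a) * subvs_of (kerp T a.+1))%type.
have -> : (\dim (kerp T a) + \dim (kerp T a.+1))%N = \dim {: W}.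
  by rewrite dimvf.
apply/eqP; rewrite eqn_leq; apply/andP; split.
- pose g (f : {ffun 'I_a.*2.+1 -> V}) : W :=
    (vsproj (kerp T a) (at_nat f a.*2.-1), vsproj (kerp T a.+1) (at_nat f a.*2)).
  have ker_g f : f \in lker (ext (@pr 2 a.*2.+1) T) ->
      at_nat f a.*2.-1 \in kerp T a /\ at_nat f a.*2 \in kerp T a.+1.
    move=> fT; rewrite !mem_kerp -!iter_opp_eq0.
    rewrite !(lker_ext_pr_iter _ fT) //=; last by lia.
    by rewrite !ifF //; lia.
  apply: (@dim_le_inj _ _ _ _ g) => [c u v|f _|f fT].
  + have at_lin n : at_nat (c *: u + v) n = c *: at_nat u n + at_nat v n.
      rewrite /at_nat; case: insub => [i|] /=; rewrite ?ffunE //.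
      by rewrite scaler0 addr0.
    by rewrite /g !at_lin !linearP.
  + exact: memvf.
  + have [f1 f2] := ker_g f fT.
    move=> [/(congr1 vsval) + /(congr1 vsval)]; rewrite !vsprojK // => {}f1 {}f2.
    apply/ffunP => i; rewrite ffunE -at_natE; have lt_i := ltn_ord i.
    have [odd_i|even_i] := boolP (odd i).
      have := lker_ext_pr_iter (a - i./2.+1) fT (_ : a.*2.-1 < a.*2.+1)%N.
      rewrite f1 ifT; last by lia.
      have -> : (a.*2.-1 - 2 * (a - i./2.+1) = i)%N by lia.
      by move=> <- //; [apply/eqP; rewrite iter_opp_eq0 iter_lfun0|lia].
    have := lker_ext_pr_iter (a - i./2) fT (ltnSn _).
    rewrite f2 ifT; last by lia.
    have -> : (a.*2 - 2 * (a - i./2) = i)%N by lia.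
    by move=> <-; apply/eqP; rewrite iter_opp_eq0 iter_lfun0.
- pose h (w : W) : {ffun 'I_a.*2.+1 -> V} := [ffun i : 'I__ =>
    if odd i then iter (a - i./2.+1) (fun u => - T u) (vsval w.1)
    else iter (a - i./2) (fun u => - T u) (vsval w.2)].
  apply: (@dim_le_inj _ _ _ _ h) => [c u v|[u v] _|[u v] _ /ffunP uv0].
  + have lin1 : vsval (c *: u + v).1 = c *: vsval u.1 + vsval v.1.
      by rewrite -linearP.
    have lin2 : vsval (c *: u + v).2 = c *: vsval u.2 + vsval v.2.
      by rewrite -linearP.
    apply/ffunP => i; rewrite !ffunE lin1 lin2.
    by case: ifP => _; rewrite !iter_opp iter_lfunP scalerDr !scalerA mulrC.
  + rewrite memv_ker; apply/eqP/ffunP => i; rewrite extE !ffunE /= /pr.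
    have lt_i := ltn_ord i.
    have [i2|i2] := boolP (2 <= i)%N; rewrite /= ?ffunE /=.
      rewrite oddB //= addbF; case: ifP => oi.
        have -> : (a - (i - 2)./2.+1 = (a - i./2.+1).+1)%N by lia.
        by rewrite iterS addrN.
      have -> : (a - (i - 2)./2 = (a - i./2).+1)%N by lia.
      by rewrite iterS addrN.
    apply/eqP; rewrite addr0 -oppr_eq0; case: ifP => oi.
      rewrite -(iterS _ (fun u => - T u)) iter_opp_eq0 -mem_kerp.
      have -> : ((a - i./2.+1).+1 = a)%N by lia.
      exact: subvsP.
    rewrite -(iterS _ (fun u => - T u)) iter_opp_eq0 -mem_kerp.
    have -> : (a - i./2 = a)%N by lia.
    exact: subvsP.
  + have lt1 : (a.*2.-1 < a.*2.+1)%N by lia.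
    move: (uv0 (Ordinal lt1)) (uv0 ord_max); rewrite !ffunE /= ifT; last by lia.
    have -> : (a - (a.*2.-1)./2.+1 = 0)%N by lia.
    rewrite odd_double doubleK subnn /= => u0 v0.
    by congr (_, _); apply: val_inj.
Qed.

(** Multiplication by eps on k[eps]/eps^2: [false] indexes the coefficient of 1 and [true] that of
    eps. *)
Definition pr_bool (b : bool) : option bool := if b then Some false else None.

(** As eps^2 = 0, only two terms of the binomial expansion of (T + eps)^(j+1) survive. *)
Lemma iter_ext_bool (V : vectType k) (T : 'End(V)) j f :
  iter j.+1 (ext pr_bool T) f = [ffun b : bool =>
    if b then iter j.+1 T (f true) + j.+1%:R *: iter j T (f false)
    else iter j.+1 T (f false)].
Proof.
elim: j => [|j IH].
  apply/ffunP => -[]; rewrite /= extE ffunE /= ?addr0 //; by rewrite scale1r.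
rewrite iterS {}IH; apply/ffunP => -[]; rewrite extE !ffunE /= ?ffunE ?addr0 //.
rewrite linearD linearZ /= -addrA; congr (_ + _).
by rewrite -[j.+2%:R]natr1 scalerDl scale1r.
Qed.

(* On V[eps]/eps^2 the kernel of (T + eps)^j is described by (v0, v1) with
   T^j v0 = 0 and T^(j-1) (T v1 + j v0) = 0; when j is invertible,
   (T v1 + j v0, v1) are coordinates on it, ranging over ker T^(j-1) and
   ker T^(j+1). *)
Lemma kerp_ext_bool (V : vectType k) (T : 'End(V)) j : j.+1%:R != 0 :> k ->
  \dim (kerp (ext pr_bool T) j.+1) = (\dim (kerp T j) + \dim (kerp T j.+2))%N.
Proof.
move=> j_neq0; pose W : vectType k := (subvs_of (kerp T j) * subvs_of (kerp T j.+2))%type.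
have -> : (\dim (kerp T j) + \dim (kerp T j.+2))%N = \dim {: W}.
  by rewrite dimvf.
have TjD u v n : iter n T (u + v) = iter n T u + iter n T v.
  by rewrite -[u]scale1r iter_lfunP !scale1r.
have TjZ c v n : iter n T (c *: v) = c *: iter n T v.
  by rewrite -[c *: v]addr0 iter_lfunP iter_lfun0 addr0.
apply/eqP; rewrite eqn_leq; apply/andP; split.
- pose g (f : {ffun bool -> V}) : W :=
    (vsproj (kerp T j) (T (f true) + j.+1%:R *: f false),
     vsproj (kerp T j.+2) (f true)).
  apply: (@dim_le_inj _ _ _ _ g) => [c u v|f _|f].
  + have lin1 : T ((c *: u + v) true) + j.+1%:R *: (c *: u + v) false
      = c *: (T (u true) + j.+1%:R *: u false)
        + (T (v true) + j.+1%:R *: v false).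
      rewrite !ffunE linearP !scalerDr !scalerA addrACA.
      by rewrite [_ * c]mulrC.
    by rewrite /g lin1 !ffunE !linearP.
  + exact: memvf.
  + rewrite mem_kerp iter_ext_bool => /eqP/ffunP Tf.
    move: (Tf true) (Tf false); rewrite !ffunE => T1 T0.
    have in1 : T (f true) + j.+1%:R *: f false \in kerp T j.
      by rewrite mem_kerp TjD TjZ -iterSr T1.
    have in2 : f true \in kerp T j.+2.
      move/(congr1 T): T1; rewrite linearD linearZ /=; move: T0 => /= ->.
      by rewrite scaler0 addr0 linear0 mem_kerp /= => ->.
    move=> [/(congr1 vsval) + /(congr1 vsval)]; rewrite !vsprojK //.
    move=> + f1; rewrite f1 linear0 add0r => /eqP.
    rewrite scaler_eq0 (negPf j_neq0) /= => /eqP f0.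
    by apply/ffunP => -[]; rewrite ffunE.
- pose h (w : W) : {ffun bool -> V} := [ffun b : bool =>
    if b then vsval w.2 else j.+1%:R^-1 *: (vsval w.1 - T (vsval w.2))].
  apply: (@dim_le_inj _ _ _ _ h) => [c u v|[u v] _|[u v] _ /ffunP uv0].
  + have lin1 : vsval (c *: u + v).1 = c *: vsval u.1 + vsval v.1.
      by rewrite -linearP.
    have lin2 : vsval (c *: u + v).2 = c *: vsval u.2 + vsval v.2.
      by rewrite -linearP.
    apply/ffunP => b; rewrite !ffunE lin1 lin2; case: b => //.
    rewrite linearP opprD addrACA -scalerN -scalerDr scalerDr !scalerA.
    by rewrite -scalerDr [LHS]scalerDr scalerA mulrC.
  + have := subvsP u; have := subvsP v; rewrite !mem_kerp => /eqP Tv /eqP Tu.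
    rewrite iter_ext_bool; apply/eqP/ffunP => -[]; rewrite !ffunE /= -?iterS.
      rewrite TjZ scalerA divff // scale1r TjD Tu add0r -scaleN1r TjZ scaleN1r.
      by rewrite -iterSr addrN.
    rewrite TjZ TjD iterS Tu linear0 add0r -scaleN1r TjZ.
    by rewrite -iterSr Tv !scaler0.
  + move: (uv0 true) (uv0 false); rewrite !ffunE /= => v0 /eqP.
    rewrite scaler_eq0 invr_eq0 (negPf j_neq0) /= v0 linear0 subr0 => /eqP u0.
    by congr (_, _); apply: val_inj.
Qed.

(** In this case (T + eps)^(j+1) = T^(j+1), acting on two copies of V. *)
Lemma kerp_ext_bool0 (V : vectType k) (T : 'End(V)) j : j.+1%:R = 0 :> k ->
  \dim (kerp (ext pr_bool T) j.+1) = (2 * \dim (kerp T j.+1))%N.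
Proof.
move=> j_eq0; transitivity (#|{: bool}| * \dim (kerp T j.+1))%N; last first.
  by rewrite card_bool.
rewrite -(lker_ext_pr1 T) -lker_ext_None.
rewrite (intertwined_lker (intertwined_swap T _ _)) lker_ext_pr1.
congr (\dim _); apply/vspaceP => f; rewrite !mem_kerp iter_ext_bool j_eq0.
suff -> : iter j.+1 (ext (fun=> None) T) f = [ffun b : bool => iter j.+1 T (f b)].
  by congr (_ == _); apply/ffunP => -[]; rewrite !ffunE ?scale0r ?addr0.
elim: j.+1 => [|n IH]; first by apply/ffunP => b; rewrite ffunE.
by rewrite iterS IH; apply/ffunP => b; rewrite extE !ffunE addr0.
Qed.

(** * The discrete wave equation for K(j, l) *)

Section Wave.
Variables (V : vectType k) (T : 'End(V)).

Definition Kdim j l := \dim (kerp (ext (@pr 1 j) T) l).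

(** Both sides are the dimension of the kernel of T + y + z on V[y, z]/(y^j, z^l). *)
Lemma KdimC j l : Kdim j l = Kdim l j.
Proof.
rewrite /Kdim -[LHS]lker_ext_pr1 -[RHS]lker_ext_pr1.
exact/intertwined_lker/intertwined_swap.
Qed.

Lemma Kdim0l l : Kdim 0 l = 0%N.
Proof. by rewrite KdimC /Kdim kerp0. Qed.

Lemma Kdim1l l : Kdim 1 l = \dim (kerp T l).
Proof. by rewrite KdimC /Kdim kerp1 lker_ext_pr1. Qed.

Lemma kerp_bool_sym j l :
  \dim (kerp (ext pr_bool (ext (@pr 1 j) T)) l)
    = \dim (kerp (ext pr_bool (ext (@pr 1 l) T)) j).
Proof.
rewrite -[LHS]lker_ext_pr1 -[RHS]lker_ext_pr1.
rewrite [LHS](intertwined_lker (intertwined_swap _ _ _)).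
rewrite [RHS](intertwined_lker (intertwined_swap _ _ _)).
exact/intertwined_lker/intertwined_ext/intertwined_swap.
Qed.

(* Both sides are the dimension of the kernel of T + y + z + eps on
   V[y, z, eps]/(y^j, z^l, eps^2), with eps absorbed into y or into z. *)
Lemma Kdim_wave j l : j.+1%:R != 0 :> k -> l.+1%:R != 0 :> k ->
  (Kdim j l.+1 + Kdim j.+2 l.+1 = Kdim j.+1 l + Kdim j.+1 l.+2)%N.
Proof.
move=> j0 l0; rewrite -[RHS]kerp_ext_bool // kerp_bool_sym kerp_ext_bool //.
by rewrite KdimC [Kdim j.+2 _]KdimC.
Qed.

(** When the characteristic divides l + 1, adjoining eps doubles the kernel, so K(j, l + 1) has
    vanishing second difference in j; this supplies the boundary values at l + 1 = p. *)
Lemma Kdim_wave0 j l : j.+1%:R != 0 :> k -> l.+1%:R = 0 :> k ->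
  (Kdim j l.+1 + Kdim j.+2 l.+1 = 2 * Kdim j.+1 l.+1)%N.
Proof.
move=> j0 l0; rewrite -[RHS]kerp_ext_bool0 // kerp_bool_sym kerp_ext_bool //.
by rewrite KdimC [Kdim j.+2 _]KdimC.
Qed.

End Wave.
End KernelDimension.
(** * Fusion numbers and the exact dimensions at level p *)

Lemma big_ord_double (T : Type) (idx : T) (op : Monoid.com_law idx)
    (F : nat -> T) n :
  \big[op/idx]_(i < n.*2) F i
    = op (\big[op/idx]_(i < n) F i.*2) (\big[op/idx]_(i < n) F i.*2.+1).
Proof.
elim: n => [|n IH]; first by rewrite !big_ord0 Monoid.mulm1.
rewrite doubleS 2!big_ord_recr /= IH.
rewrite [\big[op/idx]_(i < n.+1) F i.*2]big_ord_recr.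
rewrite [\big[op/idx]_(i < n.+1) F i.*2.+1]big_ord_recr /=.
by rewrite Monoid.mulmACA Monoid.mulmA.
Qed.

Section FusionCount.
Variable a : nat.
Local Notation q := (a.*2.+1).

(* fus 0 m = floor (m / 2q) + ceil (m / 2q). *)
Fixpoint fus (N : nat) (m : int) : int :=
  if N is N'.+1 then \sum_(e < q) fus N' (m + e%:Z - a%:Z)
  else (m %/ (q.*2)%:Z)%Z - ((- m) %/ (q.*2)%:Z)%Z.

Lemma fusS N m : fus N.+1 m = \sum_(e < q) fus N (m + e%:Z - a%:Z).
Proof. by []. Qed.

Lemma fusN N m : fus N (- m) = - fus N m.
Proof.
elim: N m => [|N IH] m; first by rewrite /= opprK opprB.
rewrite !fusS (reindex_inj rev_ord_inj) /= -sumrN; apply: eq_bigr => e _.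
by rewrite -IH; congr (fus N _); have := ltn_ord e; lia.
Qed.

Lemma fus_period N m : fus N (m + (q.*2)%:Z) = fus N m + (2 * q ^ N)%:Z.
Proof.
elim: N m => [|N IH] m.
  have -> : m + (q.*2)%:Z = 1 * (q.*2)%:Z + m by lia.
  rewrite /= -[- (_ + m)]/(- (1 * (q.*2)%:Z + m)) opprD -mulNr.
  by rewrite !divzMDl //; lia.
rewrite !fusS (eq_bigr (fun e : 'I_q => fus N (m + e%:Z - a%:Z)
  + (2 * q ^ N)%:Z)); last by move=> e _; rewrite -IH; congr (fus _ _); lia.
rewrite big_split /= sumr_const card_ord; congr (_ + _).
by rewrite expnS -mulr_natr natz -PoszM; congr Posz; lia.
Qed.

Lemma fus0r N : fus N 0 = 0.
Proof. by have := fusN N 0; rewrite oppr0; move: (fus N 0) => x; lia. Qed.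

Lemma fus_q N : fus N q%:Z = (q ^ N)%:Z.
Proof.
have := fusN N q%:Z; have := fus_period N (- q%:Z).
have -> : - q%:Z + (q.*2)%:Z = q%:Z by lia.
by lia.
Qed.

Lemma fus_reflect N m : fus N (q%:Z + m) + fus N (q%:Z - m) = (2 * q ^ N)%:Z.
Proof.
have := fusN N (q%:Z - m); have := fus_period N (m - q%:Z).
have -> : m - q%:Z + (q.*2)%:Z = q%:Z + m by lia.
have -> : - (q%:Z - m) = m - q%:Z by lia.
by lia.
Qed.

(* d'Alembert's solution of the discrete wave equation. *)
Definition wave_sum N j (x : int) : int :=
  \sum_(t < j) fus N (x - j%:Z + 1 + 2 * t%:Z).

Lemma wave_sum_rec N j x :
  wave_sum N j.+2 x + wave_sum N j x
    = wave_sum N j.+1 (x - 1) + wave_sum N j.+1 (x + 1).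
Proof.
rewrite /wave_sum big_ord_recr [X in _ = _ + X]big_ord_recr /= -!addrA.
congr (_ + _); first by apply: eq_bigr => t _; congr (fus _ _); lia.
rewrite addrC; congr (_ + _); last by congr (fus _ _); lia.
by apply: eq_bigr => t _; congr (fus _ _); lia.
Qed.

Lemma wave_sum_at0 N j : wave_sum N j 0 = 0.
Proof.
have : wave_sum N j 0 = - wave_sum N j 0.
  rewrite /wave_sum {1}(reindex_inj rev_ord_inj) /= -sumrN.
  apply: eq_bigr => t _; rewrite -fusN; congr (fus _ _).
  by have := ltn_ord t; lia.
lia.
Qed.

Lemma wave_sum_atq N j : wave_sum N j q%:Z = (j * q ^ N)%:Z.
Proof.
have : wave_sum N j q%:Z + wave_sum N j q%:Z = (2 * (j * q ^ N))%:Z.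
  rewrite /wave_sum {1}(reindex_inj rev_ord_inj) /= -big_split /=.
  rewrite (eq_bigr (fun=> (2 * q ^ N)%:Z)) => [|t _].
    by rewrite sumr_const card_ord -mulr_natr natz -PoszM; congr Posz; lia.
  rewrite -(fus_reflect N (- (q%:Z - (q%:Z - j%:Z + 1 + 2 * t%:Z)))).
  rewrite addrC; congr (fus _ _ + fus _ _); have := ltn_ord t; lia.
lia.
Qed.

(** The two sums have step 2 and interleave, filling the window from x - a to x + a. They correspond
    to the two summands of [lker_ext_pr2]. *)
Lemma wave_sum_window N x :
  wave_sum N a x + wave_sum N a.+1 x = fus N.+1 x.
Proof.
rewrite fusS big_ord_recr (big_ord_double _ (fun e => fus N (x + e%:Z - a%:Z))) /=.
rewrite /wave_sum [in LHS]addrC big_ord_recr /= addrAC.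
congr (_ + _ + _); last by congr (fus _ _); lia.
all: by apply: eq_bigr => t _; congr (fus _ _); lia.
Qed.
End FusionCount.

(** * Exact kernel dimensions at level p *)

Section PrimeLevel.
Variables (k : fieldType) (a : nat).
Local Notation p := (a.*2.+1).
Hypothesis p_char : p \in [pchar k].
Hypothesis a_gt0 : (0 < a)%N.

Lemma natr_neq0 j : (0 < j < p)%N -> j%:R != 0 :> k.
Proof.
move=> /andP[j0 jp]; rewrite -(dvdn_pcharf p_char).
by apply/negP => /(dvdn_leq j0); rewrite leqNgt jp.
Qed.

Variables (V : vectType k) (T : 'End(V)) (N : nat).
Hypothesis kerT : forall l, (l <= p)%N -> (\dim (kerp T l))%:Z = fus a N l%:Z.

Lemma Kdim_p j : (j <= p)%N -> Kdim T j p = (j * Kdim T 1 p)%N.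
Proof.
have p0 : p%:R = 0 :> k by apply: pcharf0.
elim/ltn_ind: j => -[|[|j]] IH jp; [by rewrite Kdim0l|by rewrite mul1n|].
have := Kdim_wave0 T (natr_neq0 (_ : 0 < j.+1 < p)%N) p0.
by rewrite (IH j) ?(IH j.+1) //; lia.
Qed.

(** Both sides satisfy the same wave equation, valid for 0 < j, l < p where these are invertible in
    k, and agree for j = 0, j = 1, l = 0 and l = p. *)
Lemma Kdim_wave_sum j l : (j <= p)%N -> (l <= p)%N ->
  (Kdim T j l)%:Z = wave_sum a N j l%:Z.
Proof.
have K1 m : (m <= p)%N -> (Kdim T 1 m)%:Z = fus a N m%:Z.
  by move=> ?; rewrite Kdim1l kerT.
elim/ltn_ind: j l => -[|[|j]] IH l jp lp.
- by rewrite Kdim0l /wave_sum big_ord0.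
- by rewrite K1 // /wave_sum big_ord1 /=; congr (fus _ _ _); lia.
have [->|l0] := posnP l; first by rewrite KdimC Kdim0l wave_sum_at0.
have [->|lNp] := eqVneq l p.
  by rewrite wave_sum_atq Kdim_p // PoszM K1 // fus_q -PoszM.
case: l => // l in l0 lp lNp *.
have := Kdim_wave T (natr_neq0 (_ : 0 < j.+1 < p)%N)
  (natr_neq0 (_ : 0 < l.+1 < p)%N).
have := wave_sum_rec a N j l.+1%:Z.
rewrite -(IH j) ?(ltnW jp) //; try lia.
have -> : l.+1%:Z - 1 = l%:Z by lia.
have -> : l.+1%:Z + 1 = l.+2%:Z by lia.
by rewrite -!(IH j.+1) //; lia.
Qed.

(** With y^l = 0 adjoined, the left side is the kernel of T + y + x^2, and removing x gives K(l, a)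
    + K(l, a + 1). *)
Lemma kerp_ext_pr2 l : (l <= p)%N ->
  (\dim (kerp (ext (@pr 2 p) T) l))%:Z = fus a N.+1 l%:Z.
Proof.
move=> lp; rewrite -lker_ext_pr1 (intertwined_lker (intertwined_swap _ _ _)).
rewrite lker_ext_pr2 // -wave_sum_window -!/(Kdim T _ _) ![Kdim T l _]KdimC.
by rewrite PoszD !Kdim_wave_sum //; lia.
Qed.
End PrimeLevel.
(** * Truncated polynomial rings *)

Section TruncatedPolynomials.
Variable k : fieldType.

Notation box q N := {ffun 'I_N -> 'I_q}.
Notation trunc q N := {ffun box q N -> k^o}.

(** Exponents of the monomial [m] divided by the [c]-th power of the [i]-th variable, or [None] if
    it is not divisible. *)
Definition dec c q N (i : 'I_N) (m : box q N) : option (box q N) :=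
  omap (fun x => [ffun j => if j == i then x else m j]) (pr c (m i)).

Definition flat_fun c q N (g : trunc q N) : trunc q N :=
  [ffun m => \sum_i oapp g 0 (dec c i m)].

Lemma flat_fun_linear c q N : linear (@flat_fun c q N).
Proof.
move=> a f g; apply/ffunP => m; rewrite !ffunE scaler_sumr -big_split /=.
apply: eq_bigr => i _; case: (dec _ _ _) => [m'|] /=; rewrite ?ffunE //.
by rewrite scaler0 addr0.
Qed.

HB.instance Definition _ c q N :=
  GRing.isLinear.Build _ _ _ _ _ (@flat_fun_linear c q N).

(* Multiplication by the sum of the c-th powers of the variables on
   k[x_1, ..., x_N]/(x_1^q, ..., x_N^q), in the monomial basis. *)
Definition flat c q N : 'End(trunc q N) := linfun (@flat_fun c q N).

Lemma flatE c q N (g : trunc q N) m :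
  flat c q N g m = \sum_i oapp g 0 (dec c i m).
Proof. by rewrite lfunE /= ffunE. Qed.

Definition box_cons q N (x : 'I_q) (m : box q N) : box q N.+1 :=
  [ffun i => oapp m x (unlift ord0 i)].

Lemma box_cons0 q N x (m : box q N) : box_cons x m ord0 = x.
Proof. by rewrite ffunE unlift_none. Qed.

Lemma box_consS q N x (m : box q N) i : box_cons x m (lift ord0 i) = m i.
Proof. by rewrite ffunE liftK. Qed.

Lemma box_consK q N (m : box q N.+1) :
  box_cons (m ord0) [ffun i => m (lift ord0 i)] = m.
Proof.
by apply/ffunP => i; rewrite ffunE; case: unliftP => [j|] -> //=; rewrite ffunE.
Qed.

Lemma dec_cons0 c q N (x : 'I_q) (m : box q N) :
  dec c ord0 (box_cons x m) = omap (fun y => box_cons y m) (pr c x).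
Proof.
rewrite /dec box_cons0; case: (pr c x) => //= y; congr Some; apply/ffunP => i.
by rewrite !ffunE; case: unliftP => [j|] ->; rewrite //= eqxx.
Qed.

Lemma dec_consS c q N (x : 'I_q) (m : box q N) i :
  dec c (lift ord0 i) (box_cons x m) = omap (box_cons x) (dec c i m).
Proof.
rewrite /dec box_consS; case: (pr c (m i)) => //= y; congr Some.
apply/ffunP => j; rewrite !ffunE; case: unliftP => [j'|] -> //=.
by rewrite ffunE (inj_eq lift_inj).
Qed.

Lemma flat_ext c q N :
  intertwined (flat c q N.+1) (ext (@pr c q) (flat c q N)).
Proof.
exists (fun g : trunc q N.+1 => [ffun x => [ffun m => g (box_cons x m)]]),
  (fun f : {ffun 'I_q -> trunc q N} =>
     [ffun m : box q N.+1 => f (m ord0) [ffun i => m (lift ord0 i)]]).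
split=> [a u v|a u v|g|f|g].
- by apply/ffunP => x; apply/ffunP => m; rewrite !ffunE.
- by apply/ffunP => x; rewrite !ffunE.
- by apply/ffunP => m; rewrite !ffunE box_consK.
- apply/ffunP => x; apply/ffunP => m; do 3 rewrite ffunE; rewrite box_cons0.
  by congr (f _ _); apply/ffunP => i; rewrite ffunE box_consS.
apply/ffunP => x; apply/ffunP => m.
rewrite extE !ffunE flatE big_ord_recl addrC /=; congr (_ + _).
  rewrite flatE; apply: eq_bigr => i _; rewrite dec_consS.
  by case: (dec c i m) => //= m'; rewrite !ffunE.
by rewrite dec_cons0; case: (pr c x) => [y|] /=; rewrite !ffunE.
Qed.

Lemma flat0 c q : flat c q 0 = 0.
Proof.
by apply/lfunP => g; apply/ffunP => m; rewrite flatE big_ord0 lfunE ffunE.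
Qed.

Lemma dim_trunc q N : \dim {: trunc q N} = (q ^ N)%N.
Proof. by rewrite dimvf /dim /= card_ffun !card_ord muln1. Qed.

Lemma mix_subproof q r (d : 'I_r) (b : 'I_q) : (d + r * b < q * r)%N.
Proof. by have := ltn_ord d; have := ltn_ord b; nia. Qed.

(** Exponents in base r: A_N(q r) is free over the subring generated by the r-th powers of the
    variables, with the monomials [d] as basis, and [b] gives the exponents of those r-th powers. *)
Definition mix q r N (d : box r N) (b : box q N) : box (q * r) N :=
  [ffun i => Ordinal (mix_subproof (d i) (b i))].

Lemma quo_subproof q r (x : 'I_(q * r)) : (x %/ r < q)%N.
Proof.
move: (nat_of_ord x) (ltn_ord x); case: r {x} => [|r] x; first by rewrite muln0.
by rewrite ltn_divLR.
Qed.

Lemma rem_subproof q r (x : 'I_(q * r)) : (x %% r < r)%N.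
Proof.
move: (nat_of_ord x) (ltn_ord x); case: r {x} => [|r] x; first by rewrite muln0.
by rewrite ltn_mod.
Qed.

Definition box_quo q r N (m : box (q * r) N) : box q N :=
  [ffun i => Ordinal (quo_subproof (m i))].
Definition box_rem q r N (m : box (q * r) N) : box r N :=
  [ffun i => Ordinal (rem_subproof (m i))].

Lemma mixK q r N (m : box (q * r) N) : mix (box_rem m) (box_quo m) = m.
Proof.
apply/ffunP => i; apply: val_inj; rewrite !ffunE /=.
by rewrite addnC mulnC -divn_eq.
Qed.

Lemma mix_quo q r N (d : box r N) (b : box q N) : box_quo (mix d b) = b.
Proof.
apply/ffunP => i; apply: val_inj; rewrite !ffunE /=.
have lt_d := ltn_ord (d i); rewrite addnC mulnC divnMDl; last by lia.
by rewrite divn_small ?addn0.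
Qed.

Lemma mix_rem q r N (d : box r N) (b : box q N) : box_rem (mix d b) = d.
Proof.
apply/ffunP => i; apply: val_inj; rewrite !ffunE /=.
by rewrite addnC mulnC modnMDl modn_small.
Qed.

Lemma dec_mix c q r N i (d : box r N) (b : box q N) :
  dec (c * r) i (mix d b) = omap (mix d) (dec c i b).
Proof.
have lt_d := ltn_ord (d i).
have r0 : (0 < r)%N by lia.
rewrite /dec /pr ffunE /=.
have -> : (c * r <= d i + r * b i)%N = (c <= b i)%N.
  apply/idP/idP => [le_cb|]; last by nia.
  by rewrite leqNgt; apply/negP => lt_bc; nia.
case: ifP => //= le_cb; congr Some; apply/ffunP => j; apply: val_inj.
rewrite !ffunE; case: eqP => [->|_] //=.
nia.
Qed.

Lemma flat_scale c q r N : intertwined (flat (c * r) (q * r) N)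
  (ext (fun _ : box r N => None) (flat c q N)).
Proof.
exists (fun g : trunc (q * r) N => [ffun d => [ffun b => g (mix d b)]]),
  (fun f : {ffun box r N -> trunc q N} =>
     [ffun m => f (box_rem m) (box_quo m)]).
split=> [a u v|a u v|g|f|g].
- by apply/ffunP => x; apply/ffunP => m; rewrite !ffunE.
- by apply/ffunP => x; rewrite !ffunE.
- by apply/ffunP => m; rewrite !ffunE mixK.
- by apply/ffunP => x; apply/ffunP => m; rewrite !ffunE mix_quo mix_rem.
apply/ffunP => x; apply/ffunP => m.
rewrite extE !ffunE addr0 !flatE; apply: eq_bigr => i _.
by rewrite dec_mix; case: (dec c i m) => //= m'; rewrite ffunE.
Qed.

(** * From polynomials to the truncated ring, and the length of the quotient *)

Definition box_mnm q N (m : box q N) : 'X_{1..N} := [multinom (m i : nat) | i < N].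

Definition truncate q N (h : {mpoly k[N]}) : trunc q N :=
  [ffun m => h@_(box_mnm m)].

Lemma truncate_linear q N : linear (@truncate q N).
Proof. by move=> a g h; apply/ffunP => m; rewrite !ffunE mcoeffD mcoeffZ. Qed.

HB.instance Definition _ q N :=
  GRing.isLinear.Build _ _ _ _ _ (@truncate_linear q N).

Lemma mcoeffMX0 N (h : {mpoly k[N]}) (m m' : 'X_{1..N}) :
  ~~ (m <= m')%MM -> (h * 'X_[m])@_m' = 0.
Proof.
move=> mm'; rewrite [h]mpolyE mulr_suml raddf_sum /= big1 // => m1 _.
rewrite -scalerAl -mpolyXD mcoeffZ mcoeffX; case: eqP => [E|_]; last by rewrite mulr0.
by move: mm'; rewrite -E lem_addl.
Qed.

Lemma box_mnm_inj q N : injective (@box_mnm q N).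
Proof.
move=> m m' /mnmP E; apply/ffunP => i; apply: val_inj.
by move: (E i); rewrite !mnmE.
Qed.

Lemma truncate_mulXn q N (h : {mpoly k[N]}) c i (m : box q N) :
  truncate q (h * 'X_i ^+ c) m = oapp (truncate q h) 0 (dec c i m).
Proof.
rewrite ffunE mpolyXn /dec /pr; case: ifP => [le_cm|/negbT lt_mc] /=.
  rewrite ffunE -[RHS](mcoeffMX _ (U_(i) *+ c)); congr (mcoeff _ _); apply/mnmP => j.
  rewrite mnmDE !mnmE ffunE; case: (eqVneq j i) => [->|] /=.
    by rewrite mulmnE mnm1E eqxx mul1n addnC subnK.
  by rewrite eq_sym => /negPf ji; rewrite mulmnE mnm1E ji.
apply: mcoeffMX0; apply/negP => /mnm_lepP /(_ i).
by rewrite mulmnE mnm1E eqxx mul1n mnmE (negPf lt_mc).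
Qed.

Lemma truncate_flat q N (h : {mpoly k[N]}) c :
  truncate q (h * \sum_(i < N) 'X_i ^+ c) = flat c q N (truncate q h).
Proof.
apply/ffunP => m; rewrite flatE mulr_sumr ffunE raddf_sum /=.
by apply: eq_bigr => i _; rewrite -truncate_mulXn ffunE.
Qed.

Definition untruncate q N (v : trunc q N) : {mpoly k[N]} :=
  \sum_b v b *: 'X_[box_mnm b].

Lemma untruncateK q N : cancel (@untruncate q N) (@truncate q N).
Proof.
move=> v; apply/ffunP => m; rewrite ffunE raddf_sum /= (bigD1 m) //= big1.
  by rewrite mcoeffZ mcoeffX eqxx mulr1 addr0.
move=> m' /negPf mm'; rewrite mcoeffZ mcoeffX (inj_eq (@box_mnm_inj _ _)) mm'.
by rewrite mulr0.
Qed.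

Section IdealGen.
Variables (P : comNzRingType) (S : P -> Prop).

Lemma in_ideal_gen_mul (u g : P) : S g -> in_ideal_gen S (u * g).
Proof.
move=> Sg; exists [:: (u, g)]; rewrite big_seq1; split=> // a.
by rewrite inE => /eqP ->.
Qed.

Lemma in_ideal_gen0 : in_ideal_gen S 0.
Proof. by exists [::]; rewrite big_nil. Qed.

Lemma in_ideal_genD u v :
  in_ideal_gen S u -> in_ideal_gen S v -> in_ideal_gen S (u + v).
Proof.
move=> [l [Sl ->]] [l' [Sl' ->]]; exists (l ++ l'); rewrite big_cat; split=> // a.
by rewrite mem_cat => /orP[/Sl|/Sl'].
Qed.

End IdealGen.

Section Characteristic.
Variable p : nat.
Hypothesis p_char : p \in [pchar k].

Lemma mpoly_pchar N : p \in [pchar {mpoly k[N]}].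
Proof. exact: rmorph_pchar (@mpolyC N k) _ p_char. Qed.

Lemma mpoly_sum_expn N s (I : Type) (r : seq I) (F : I -> {mpoly k[N]}) :
  (\sum_(i <- r) F i) ^+ (p ^ s)%N = \sum_(i <- r) F i ^+ (p ^ s)%N.
Proof.
elim: s => [|s IH]; first by rewrite expn0 expr1; apply: eq_bigr => i _.
rewrite expnSr exprM IH -(pFrobenius_autE (mpoly_pchar N)) rmorph_sum.
by apply: eq_bigr => i _; rewrite exprM.
Qed.

(** The p^s-th power of a sum of c-th powers is the sum of the (c p^s)-th powers; lifting [v] to a
    polynomial makes this Frobenius identity available. *)
Lemma iter_flat s c q N v :
  iter (p ^ s)%N (flat c q N) v = flat (c * p ^ s) q N v.
Proof.
rewrite -(untruncateK v); set h := untruncate v.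
have iterE j : iter j (flat c q N) (truncate q h)
    = truncate q (h * (\sum_(i < N) 'X_i ^+ c) ^+ j).
  elim: j => [|j IH]; first by rewrite mulr1.
  by rewrite iterS IH -truncate_flat exprSr mulrA.
rewrite iterE mpoly_sum_expn -truncate_flat; congr (truncate _ (_ * _)).
by apply: eq_bigr => i _; rewrite exprM.
Qed.

(** Since q is a power of p, the q-th power of an element of the maximal ideal is a combination of
    the X_i^q. Hence the ideal is generated by the sum of squares and the X_i^q, and modulo the
    latter it becomes the image of T. *)
Lemma mem_frob_pow_ideal N s (h : {mpoly k[N]}) :
  frob_pow_ideal (sumsq k N) (p ^ s)%N h
    <-> truncate (p ^ s) h \in limg (flat 2 (p ^ s) N).
Proof.
set q := (p ^ s)%N; set T := flat 2 q N.
have T_f g : truncate q (g * sumsq k N) = T (truncate q g).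
  by rewrite /sumsq truncate_flat.
have Xq0 (g : {mpoly k[N]}) i : truncate q (g * 'X_i ^+ q) = 0.
  apply/ffunP => m; rewrite truncate_mulXn /dec /pr ifF /= ?ffunE //.
  by rewrite leqNgt ltn_ord.
split.
- move=> [l [Sl ->]]; rewrite raddf_sum /= big_seq; apply: memv_suml => a la.
  have [-> |[g [[l' [Sl' ->]] ->]]] := Sl a la.
    by rewrite T_f memv_img ?memvf.
  rewrite mpoly_sum_expn mulr_sumr raddf_sum /= big_seq big1 ?mem0v // => b lb.
  have [i ->] := Sl' b lb.
  by rewrite exprMn mulrA Xq0.
- move=> /memv_imgP[v _ hv]; set g := untruncate v.
  rewrite -[h](subrK (g * sumsq k N)); apply: in_ideal_genD; last first.
    by apply: in_ideal_gen_mul; left.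
  have {hv} : truncate q (h - g * sumsq k N) = 0.
    by rewrite linearB /= T_f untruncateK hv subrr.
  move: (h - _) => {}h /ffunP h0; rewrite [h]mpolyE big_seq.
  apply: big_ind => [||m hm]; [exact: in_ideal_gen0|exact: in_ideal_genD|].
  (* A monomial with all exponents below q would be visible in the truncation, so each one left is
     divisible by some X_i^q. *)
  have [/forallP lt_mq|/forallPn[i]] := boolP [forall i, (m i < q)%N].
    have := h0 [ffun i => Ordinal (lt_mq i)]; rewrite !ffunE.
    have -> : box_mnm [ffun i => Ordinal (lt_mq i)] = m.
      by apply/mnmP => i; rewrite mnmE ffunE.
    by move/eqP; rewrite mcoeff_eq0 hm.
  rewrite -leqNgt => le_qm.
  have -> : 'X_[m] = 'X_[m - U_(i) *+ q] * 'X_i ^+ q :> {mpoly k[N]}.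
    rewrite mpolyXn -mpolyXD submK //; apply/mnm_lepP => j.
    by rewrite mulmnE mnm1E; case: eqP => [<-|]; rewrite ?mul1n ?mul0n.
  rewrite scalerAl; apply: in_ideal_gen_mul; right; exists 'X_i; split=> //.
  by rewrite -['X_i]mul1r; apply: in_ideal_gen_mul; exists i.
Qed.

(** A complement of the image of T lifts to a basis of the quotient, and by rank-nullity its
    dimension is that of the kernel. *)
Lemma quot_dim_frob N s :
  quot_dim (frob_pow_ideal (sumsq k N) (p ^ s)%N)
    (\dim (lker (flat 2 (p ^ s) N))).
Proof.
set q := (p ^ s)%N; set T := flat 2 q N; pose C := ((limg T)^C)%VS.
have <- : \dim C = \dim (lker T).
  rewrite dimv_compl -(limg_ker_dim T fullv) addnK.
  by rewrite (capv_idPr (subvf _)).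
exists (fun i => untruncate (vbasis C)`_i).
have truncE (c : 'I_(\dim C) -> k) :
    truncate q (\sum_(i < \dim C) c i *: untruncate (vbasis C)`_i)
      = \sum_(i < \dim C) c i *: (vbasis C)`_i.
  by rewrite raddf_sum /=; apply: eq_bigr => i _; rewrite linearZ /= untruncateK.
split.
- move=> g; have : truncate q g \in (limg T + C)%VS by rewrite addv_complf memvf.
  move=> /memv_addP[u uT [w wC E]].
  exists (fun i => coord (vbasis C) i w).
  apply/mem_frob_pow_ideal; rewrite linearB /= truncE.
  by rewrite -(coord_vbasis wC) E addrK.
- move=> c /mem_frob_pow_ideal; rewrite truncE => inT.
  have : \sum_(i < \dim C) c i *: (vbasis C)`_i \in (limg T :&: C)%VS.
    rewrite memv_cap inT; apply: memv_suml => i _; apply/memvZ/vbasis_mem.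
    by apply: mem_nth; rewrite size_tuple.
  rewrite capv_compl memv0 => /eqP; apply: freeP.
  exact: basis_free (vbasisP C).
Qed.

End Characteristic.

(** [flat_scale] splits the space into r^N copies; the power j is turned into an extra variable so
    that [lker_ext_None] applies. *)
Lemma flat_kerp_scale q r N j : (\dim (kerp (flat (2 * r) (q * r) N) j)
  = r ^ N * \dim (kerp (flat 2 q N) j))%N.
Proof.
rewrite (intertwined_kerp _ (flat_scale _ _ _ _)).
rewrite -lker_ext_pr1 (intertwined_lker (intertwined_swap _ _ _)).
by rewrite lker_ext_None lker_ext_pr1 card_ffun !card_ord.
Qed.

Lemma flat_kerp_pow p s q N j : p \in [pchar k] ->
  (\dim (kerp (flat 2 (q * p ^ s) N) (p ^ s * j))
    = (p ^ s) ^ N * \dim (kerp (flat 2 q N) j))%N.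
Proof.
move=> p_char; rewrite -flat_kerp_scale; congr (\dim _).
apply/vspaceP => v; rewrite !mem_kerp; congr (_ == _).
elim: j v => [|j IH] v; first by rewrite muln0.
by rewrite mulnS iterD IH iterS (iter_flat p_char) -iterS iterSr.
Qed.
End TruncatedPolynomials.
(** * The lower bound at every level *)

Section GradedKernel.
Variable k : fieldType.

(* The kernels on the pieces of degrees r, r + 2, r + 4, ... account for the
   successive drops of dimension of the images of Vs r. *)
Lemma dim_graded_le (V : vectType k) (T : 'End(V)) (Vs : nat -> {vspace V}) n r :
  (forall i v, v \in Vs i -> T v \in Vs i.+2) ->
  (forall v, iter n T v = 0) ->
  (\dim (Vs r) <= \sum_(t < n) \dim (Vs (r + t.*2)%N :&: lker T))%N.
Proof.
move=> gT Tn0; pose W t := (iter t (comp_lfun T) \1%VF @: Vs r)%VS.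
have WV t : (W t <= Vs (r + t.*2)%N)%VS.
  apply/subvP => _ /memv_imgP[v vr ->]; rewrite iter_lfunE.
  elim: t => [|t IH]; first by rewrite addn0.
  by rewrite iterS doubleS 2!addnS gT.
suff dimW m : (\dim (Vs r) <= \sum_(t < m) \dim (Vs (r + t.*2)%N :&: lker T)
    + \dim (W m))%N.
  suff W0 : W n = 0%VS by have := dimW n; rewrite W0 dimv0 addn0.
  apply/eqP; rewrite -subv0; apply/subvP => _ /memv_imgP[v _ ->].
  by rewrite iter_lfunE Tn0 mem0v.
elim: m => [|m IH].
  by rewrite big_ord0 /W /= add0n; apply/dimvS/subvP => v vr; rewrite -[v]id_lfunE memv_img.
apply: (leq_trans IH); rewrite big_ord_recr /= -addnA leq_add2l.
rewrite -(limg_ker_dim T (W m)) leq_add //; first exact/dimvS/capvS.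
by rewrite /W /= limg_comp.
Qed.
End GradedKernel.

Section LowerBound.
Variables (k : fieldType) (a N : nat).
Local Notation q := (a.*2.+1).
Local Notation box := {ffun 'I_N -> 'I_q}.
Local Notation V := {ffun box -> k^o}.
Local Notation T := (flat k 2 q N).

Definition bdeg n (b : {ffun 'I_n -> 'I_q}) : nat := \sum_i b i.

(** Erases the coefficients of degree r modulo 2q, so that its kernel is the span of the monomials
    of that class. *)
Definition off_class r (g : V) : V :=
  [ffun b => if bdeg b == r %[mod q.*2] then 0 else g b].

Lemma off_class_linear r : linear (off_class r).
Proof.
move=> c u v; apply/ffunP => b; rewrite !ffunE.
by case: ifP => _ //; rewrite scaler0 addr0.
Qed.

HB.instance Definition _ r :=
  GRing.isLinear.Build _ _ _ _ _ (off_class_linear r).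

Definition deg_class r : {vspace V} := lker (linfun (off_class r)).

Lemma deg_classP r (g : V) :
  reflect (forall b, bdeg b != r %[mod q.*2] -> g b = 0) (g \in deg_class r).
Proof.
rewrite memv_ker lfunE /=; apply: (iffP eqP) => [/ffunP g0 b /negPf br|g0].
  by move: (g0 b); rewrite !ffunE br.
apply/ffunP => b; rewrite !ffunE; case: ifP => // /negbT br; exact: g0.
Qed.

Lemma bdeg_dec c i (b b' : box) : dec c i b = Some b' -> bdeg b = (bdeg b' + c)%N.
Proof.
rewrite /dec /pr; case: ifP => //= le_cb [<-].
rewrite /bdeg (bigD1 i) //= [in RHS](bigD1 i) //= ffunE eqxx /= addnAC subnK //.
by congr (_ + _)%N; apply: eq_bigr => j /negPf ji; rewrite ffunE ji.
Qed.

Lemma flat_deg_class r g : g \in deg_class r -> T g \in deg_class r.+2.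
Proof.
move=> /deg_classP g0; apply/deg_classP => b br; rewrite flatE big1 // => i _.
case E: (dec 2 i b) => [b'|] //=; apply: g0; move: br.
by rewrite (bdeg_dec E) -[r.+2]addn2 eqn_modDr.
Qed.

Lemma dim_deg_class r :
  (#|[pred b : box | bdeg b == r %[mod q.*2]]| <= \dim (deg_class r))%N.
Proof.
set A := [pred b : box | _].
have -> : #|A| = \dim {: {ffun {b | b \in A} -> k^o}}.
  by rewrite dimvf /dim /= muln1 card_sig; apply: eq_card.
apply: (@dim_le_inj _ _ _ _ _ (fun f : {ffun {b | b \in A} -> k^o} =>
  [ffun b => oapp f 0 (insub b)] : V)) => [c u v|f _|f _ /ffunP f0].
- apply/ffunP => b; rewrite !ffunE; case: insubP => [x _ _|_] /=.
    by rewrite !ffunE.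
  by rewrite scaler0 addr0.
- by apply/deg_classP => b bA; rewrite ffunE insubN.
- by apply/ffunP => x; move: (f0 (val x)); rewrite !ffunE valK.
Qed.

Lemma deg_class_direct r (U : {vspace V}) :
  (\sum_(i < q.*2) \dim (deg_class (r + i) :&: U) <= \dim U)%N.
Proof.
have dir : directv (\sum_(i < q.*2) (deg_class (r + i) :&: U))%VS.
  apply/directv_sum_independent => us us_in sum0 i _; apply/ffunP => b.
  have us0 (j : 'I_q.*2) : bdeg b != r + j %[mod q.*2] -> us j b = 0.
    by have := us_in j isT; rewrite memv_cap => /andP[/deg_classP + _]; apply.
  rewrite ffunE; have [bi|] := eqVneq (bdeg b %% q.*2)%N ((r + i) %% q.*2)%N;
    last exact: us0.
  move/ffunP: sum0 => /(_ b); rewrite ffunE sum_ffunE (bigD1 i) //= big1 ?addr0 //.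
  move=> j ji; apply: us0; rewrite bi eqn_modDl !modn_small ?ltn_ord //.
  by rewrite eq_sym.
have /= <- := directvP dir; apply/dimvS/subv_sumP => i _; exact: capvSr.
Qed.

(** The classes r, r + 2, ... and r + 1, r + 3, ..., q of each, exhaust the residues modulo 2q once,
    and the kernel contains the direct sum of its pieces; [dim_graded_le] bounds each family. *)
Lemma lker_flat_count r : (forall v, iter q T v = 0) ->
  (#|[pred b : box | bdeg b == r %[mod q.*2]]|
   + #|[pred b : box | bdeg b == r.+1 %[mod q.*2]]| <= \dim (lker T))%N.
Proof.
move=> Tq0; apply: leq_trans (deg_class_direct r _).
rewrite (big_ord_double _ (fun i => \dim (deg_class (r + i) :&: lker T))) /=.
apply: leq_trans (leq_add (dim_deg_class r) (dim_deg_class r.+1)) _.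
apply: leq_add; first exact: dim_graded_le flat_deg_class Tq0.
apply: leq_trans (dim_graded_le r.+1 flat_deg_class Tq0) _.
by apply: leq_sum => i _; rewrite addSnnS.
Qed.
End LowerBound.

(** * Fusion numbers as counts of monomials by degree *)

Section FusionIncrement.
Variable a : nat.
Local Notation q := (a.*2.+1).

Lemma divz_succ (x d : int) : 0 < d ->
  ((x + 1) %/ d)%Z - (x %/ d)%Z = (d %| x + 1)%Z%:Z.
Proof.
move=> d0; have d_neq0 : d != 0 by lia.
have r0 := modz_ge0 (x + 1) d_neq0; have rd := ltz_pmod (x + 1) d0.
have -> : (d %| x + 1)%Z = ((x + 1) %% d == 0)%Z by apply/dvdz_mod0P/eqP.
have E := divz_eq (x + 1) d.
set m := ((x + 1) %/ d)%Z in E *; set r := ((x + 1) %% d)%Z in E r0 rd *.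
have [r_eq0|r_neq0] := eqVneq r 0.
  have -> : x = (m - 1) * d + (d - 1) by lia.
  by rewrite divzMDl // divz_small; lia.
have -> : x = m * d + (r - 1) by lia.
by rewrite divzMDl // divz_small; lia.
Qed.

Lemma big_box_cons N (F : {ffun 'I_N.+1 -> 'I_q} -> int) :
  \sum_b F b = \sum_(x < q) \sum_(b : {ffun 'I_N -> 'I_q}) F (box_cons x b).
Proof.
rewrite pair_bigA /=.
rewrite (reindex (fun xb : 'I_q * {ffun 'I_N -> 'I_q} => box_cons xb.1 xb.2)) //.
exists (fun b : {ffun 'I_N.+1 -> 'I_q} =>
  (b ord0, [ffun i => b (lift ord0 i)])) => [[x b]|b] _ /=.
  by rewrite box_cons0; congr (_, _); apply/ffunP => i; rewrite ffunE box_consS.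
exact: box_consK.
Qed.

Lemma bdeg_cons N (x : 'I_q) (b : {ffun 'I_N -> 'I_q}) :
  bdeg (box_cons x b) = (x + bdeg b)%N.
Proof.
rewrite /bdeg big_ord_recl box_cons0; congr (_ + _)%N.
by apply: eq_bigr => i _; rewrite box_consS.
Qed.

(** When the window sums are unfolded, b records the N shifts, of total [bdeg b] - N a; at the
    bottom, the floor in [fus a 0] jumps on reaching a multiple of 2q and the ceiling one step
    later. *)
Lemma fus_increment N m : fus a N m - fus a N (m - 1) =
  \sum_(b : {ffun 'I_N -> 'I_q})
    ((q.*2%:Z %| m + (bdeg b)%:Z - (N * a)%:Z)%Z%:Z
     + (q.*2%:Z %| m - 1 + (bdeg b)%:Z - (N * a)%:Z)%Z%:Z).
Proof.
elim: N m => [|N IH] m; last first.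
  rewrite big_box_cons !fusS -sumrB; apply: eq_bigr => x _.
  have -> : m - 1 + x%:Z - a%:Z = m + x%:Z - a%:Z - 1 by lia.
  rewrite IH; apply: eq_bigr => b _; rewrite bdeg_cons.
  by congr ((dvdz _ _)%:Z + (dvdz _ _)%:Z); lia.
rewrite (eq_bigr (fun=> (q.*2%:Z %| m)%Z%:Z + (q.*2%:Z %| m - 1)%Z%:Z));
  last first.
  move=> b _; rewrite /bdeg big_ord0 mul0n.
  by congr ((dvdz _ _)%:Z + (dvdz _ _)%:Z); lia.
rewrite sumr_const card_ffun !card_ord expn0 mulr1n /=.
have := divz_succ (m - 1) (isT : 0 < q.*2%:Z).
have := divz_succ (- m) (isT : 0 < q.*2%:Z).
have dN : (q.*2%:Z %| - m + 1)%Z = (q.*2%:Z %| m - 1)%Z.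
  by rewrite -rpredN; congr (dvdz _ _); lia.
rewrite subrK dN.
have -> : - (m - 1) = - m + 1 by lia.
by move=> <- <-; ring.
Qed.

(** This is the increment from [fus a N 0] = 0. The classes are N a - 1 and N a, at the middle
    degree; [q.*2.-1] stands for -1 modulo 2q. *)
Lemma fus1_count N : fus a N 1 =
  (#|[pred b : {ffun 'I_N -> 'I_q} | bdeg b == N * a + q.*2.-1 %[mod q.*2]]|
   + #|[pred b : {ffun 'I_N -> 'I_q} | bdeg b == (N * a + q.*2.-1).+1 %[mod q.*2]]|)%N%:Z.
Proof.
have := fus_increment N 1; rewrite subrr fus0r subr0 => ->.
have cardE (A : pred {ffun 'I_N -> 'I_q}) : #|A|%:Z = \sum_b (A b)%:Z.
  rewrite -sum1_card big_mkcond /= (big_morph Posz PoszD (erefl : 0%N = 0 :> int)).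
  by apply: eq_bigr => b _; rewrite unfold_in; case: (A b).
rewrite big_split PoszD !cardE /=.
have modE (b : {ffun 'I_N -> 'I_q}) r z : (q.*2%:Z %| z - ((bdeg b)%:Z - r%:Z))%Z ->
    (bdeg b == r %[mod q.*2]) = (q.*2%:Z %| z)%Z.
  move=> dz; rewrite -eqz_nat -!modz_nat eqz_mod_dvd.
  by rewrite -[in RHS](subrK ((bdeg b)%:Z - r%:Z) z) (rpredDl _ dz).
congr (_ + _); apply: eq_bigr => b _; congr Posz; congr nat_of_bool;
  by symmetry; apply: modE; apply/dvdzP; exists 1; lia.
Qed.
End FusionIncrement.

Lemma fus1_le_lker (k : fieldType) p s a N : p \in [pchar k] ->
  (p ^ s)%N = a.*2.+1 -> (fus a N 1 <= (\dim (lker (flat k 2 (p ^ s) N)))%:Z).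
Proof.
move=> p_char q_eq; rewrite fus1_count lez_nat.
(* T^q is multiplication by the sum of the 2q-th powers of the variables, which is zero. *)
have Tq0 v : iter (p ^ s) (flat k 2 a.*2.+1 N) v = 0.
  rewrite (iter_flat p_char); apply/ffunP => m; rewrite flatE ffunE big1 // => i _.
  rewrite /dec /pr q_eq ifN // -ltnNge.
  by apply: leq_trans (ltn_ord _) _; lia.
move: Tq0; rewrite q_eq => Tq0; exact: lker_flat_count.
Qed.
(** * Comparison of levels *)

Section Levels.
Variables (k : fieldType) (p : nat).
Hypothesis p_char : p \in [pchar k].

(** By Frobenius, p^(N+1) times the dimension at level p^s is dim ker T^p one level higher, hence at
    most p dim ker T there. *)
Lemma lker_flat_expS N s :
  (p ^ N * \dim (lker (flat k 2 (p ^ s) N.+1))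
    <= \dim (lker (flat k 2 (p ^ s.+1) N.+1)))%N.
Proof.
have p0 : (0 < p)%N by apply/prime_gt0/(pcharf_prime p_char).
have := flat_kerp_pow 1 (p ^ s) N.+1 1 p_char.
rewrite expn1 muln1 kerp1 -expnSr => E.
by rewrite -(leq_pmul2l p0) mulnA -expnS -E kerp_mul_le.
Qed.

Variable a : nat.
Hypothesis p_odd : p = a.*2.+1.
Hypothesis a_gt0 : (0 < a)%N.

Lemma kerp_flat_fus N l : (l <= p)%N ->
  (\dim (kerp (flat k 2 p N) l))%:Z = fus a N l%:Z.
Proof.
have p_char' := p_char; rewrite p_odd in p_char' *; elim: N l => [|N IH] l lp.
  case: l lp => [|l] lp; first by rewrite kerp0 fus0r.
  have -> : kerp (flat k 2 a.*2.+1 0) l.+1 = fullv.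
    by apply/vspaceP => v; rewrite mem_kerp iterS flat0 zero_lfunE eqxx memvf.
  rewrite dim_trunc expn0 /= divz_small; last by lia.
  have -> : - l.+1%:Z = (-1) * (a.*2.+1).*2%:Z + ((a.*2.+1).*2%:Z - l.+1%:Z) by lia.
  by rewrite divzMDl // divz_small; lia.
rewrite (intertwined_kerp _ (flat_ext _ _ _ _)).
exact: kerp_ext_pr2.
Qed.

Lemma lker_flat_upper N s :
  ((\dim (lker (flat k 2 (p ^ s.+1) N.+1)))%:Z
    <= 2 * ((p ^ s) ^ N)%N%:Z * fus a N a.+1%:Z).
Proof.
have [b b_eq] : exists b, (p ^ s = b.*2.+1)%N.
  exists (p ^ s)./2; rewrite -[LHS]odd_double_half oddX p_odd /=.
  by rewrite odd_double orbT.
(* [A] is (Q - 1)/2, and b < p^s makes [A.+1] at most p^s (a + 1). *)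
set Q := (p ^ s.+1)%N; pose A := (p ^ s * a + b)%N.
have Q_eq : Q = A.*2.+1 by rewrite /Q expnSr p_odd -p_odd /A; nia.
rewrite -(kerp_flat_fus N (_ : a.+1 <= p)%N); last by rewrite p_odd; lia.
rewrite -mulrA -PoszM -(flat_kerp_pow s p N a.+1 p_char) -expnS -/Q.
rewrite (intertwined_lker (flat_ext _ _ _ _)).
have -> : \dim (lker (ext (@pr 2 Q) (flat k 2 Q N)))
    = (\dim (kerp (flat k 2 Q N) A) + \dim (kerp (flat k 2 Q N) A.+1))%N.
  by rewrite Q_eq lker_ext_pr2 // /A; nia.
rewrite -PoszM lez_nat mul2n -addnn leq_add // kerp_le // /A; nia.
Qed.
End Levels.
(** * The recurrence for the central values *)

Section FusionDifferences.
Variable a : nat.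
Local Notation q := (a.*2.+1).

(** The slope of [fus a N] is q^(N-1), integral only for positive N; hence the shift of the
    index. *)
Definition psi (j : nat) (l : int) : int := fus a j.+1 l - l * (q ^ j)%N%:Z.

Lemma psiN j (l : int) : psi j (- l) = - psi j l.
Proof. by rewrite /psi fusN; ring. Qed.

Lemma psi_q j : psi j q%:Z = 0.
Proof. by rewrite /psi fus_q expnS PoszM subrr. Qed.

Lemma psi0r j : psi j 0 = 0.
Proof. by rewrite /psi fus0r mul0r subrr. Qed.

Lemma psiS j (l : int) : psi j.+1 l = \sum_(e < q) psi j (l + e%:Z - a%:Z).
Proof.
rewrite /psi fusS sumrB; congr (_ - _).
rewrite -mulr_suml expnS PoszM mulrA; congr (_ * _).
have -> : \sum_(e < q) (l + e%:Z - a%:Z) = l *+ q + \sum_(e < q) (e%:Z - a%:Z).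
  rewrite -[in l *+ q](card_ord q) -sumr_const -big_split /=.
  by apply: eq_bigr => e _; rewrite addrA.
have -> : \sum_(e < q) (e%:Z - a%:Z) = 0.
  set S := \sum_(e < q) _; suff : S = - S by lia.
  rewrite {1}/S (reindex_inj rev_ord_inj) /= -sumrN; apply: eq_bigr => e _.
  by have := ltn_ord e; lia.
by rewrite addr0 -mulr_natr natz.
Qed.

Lemma sum_window_step (G : int -> int) (l : int) :
  \sum_(e < q) G (l + 1 + e%:Z - a%:Z) - \sum_(e < q) G (l + e%:Z - a%:Z)
    = G (l + a%:Z + 1) - G (l - a%:Z).
Proof.
rewrite big_ord_recr [X in _ - X]big_ord_recl /= addr0.
have -> : l + 1 + a.*2%:Z - a%:Z = l + a%:Z + 1 by lia.
rewrite [X in _ - (_ + X)](eq_bigr (fun e : 'I_a.*2 => G (l + 1 + e%:Z - a%:Z))).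
  by ring.
by move=> e _; congr G; rewrite /bump /=; lia.
Qed.

Lemma fus1_antiperiod (l : int) : fus a 1 (l + q%:Z) + fus a 1 l = 2 * l + q%:Z.
Proof.
pose P (l : int) : int := fus a 1 (l + q%:Z) + fus a 1 l - 2 * l.
(* The increments of the two terms are differences of [fus a 0] whose endpoints match up to the
   period 2q; the gain 2 over a period cancels the linear term. *)
have step (x : int) : P (x + 1) = P x.
  have := sum_window_step (fus a 0) x; have := sum_window_step (fus a 0) (x + q%:Z).
  rewrite -!fusS; have -> : x + q%:Z + 1 = x + 1 + q%:Z by lia.
  have -> : x + q%:Z + a%:Z + 1 = (x - a%:Z) + q.*2%:Z by lia.
  have -> : x + q%:Z - a%:Z = x + a%:Z + 1 by lia.
  rewrite fus_period expn0 /P. lia.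
have Pn (n : nat) : P n%:Z = P 0 /\ P (- n%:Z) = P 0.
  elim: n => [|n [IH IHN]]; first by [].
  by split; [rewrite -IH -(step n%:Z); congr P; lia|rewrite -IHN -(step (- n.+1%:Z)); congr P; lia].
suff : P l = q%:Z by rewrite /P; lia.
have -> : P l = P 0.
  by case: (intP l) => [//|n|n]; [case: (Pn n.+1)|case: (Pn n.+1)].
by rewrite /P add0r fus_q expn1 fus0r; lia.
Qed.

Lemma psi_antiperiod j (l : int) : psi j (l + q%:Z) = - psi j l.
Proof.
elim: j l => [|j IH] l.
  by have := fus1_antiperiod l; rewrite /psi expn0; lia.
rewrite !psiS -sumrN; apply: eq_bigr => e _; rewrite -IH; congr (psi _ _); lia.
Qed.

(** The window sum changes by the difference of [psi j] at l + a + 1 and l - a, which are q apart,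
    so antiperiodicity doubles the first value. *)
Lemma psi_step j (l : int) : psi j.+1 (l + 1) - psi j.+1 l = 2 * psi j (l + a%:Z + 1).
Proof.
have := sum_window_step (psi j) l; rewrite -!psiS => ->.
have -> : l + a%:Z + 1 = (l - a%:Z) + q%:Z by lia.
by rewrite psi_antiperiod; ring.
Qed.

Lemma psi_step2 j (l : int) :
  psi j.+2 (l + 2) = 2 * psi j.+2 (l + 1) - psi j.+2 l - 4 * psi j (l + 1).
Proof.
have := psi_step j.+1 (l + 1); have := psi_step j.+1 l.
have := psi_step j (l + a%:Z + 1).
have -> : l + a%:Z + 1 + a%:Z + 1 = l + 1 + q%:Z by lia.
have -> : l + 1 + 1 = l + 2 by lia.
have -> : l + 1 + a%:Z + 1 = l + a%:Z + 1 + 1 by lia.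
rewrite psi_antiperiod. lia.
Qed.

Lemma psi_sym j (l : int) : psi j (q%:Z - l) = psi j l.
Proof. by rewrite addrC psi_antiperiod psiN opprK. Qed.

(** The window about a point of [a + 1, q] lies strictly between 0 and 2q, where [fus a 0] is 1, so
    [fus a 1] equals q there. *)
Lemma psi0_right (r : nat) : (r <= a)%N -> psi 0 (a%:Z + 1 + r%:Z) = a%:Z - r%:Z.
Proof.
have fus0_1 (x : nat) : (0 < x < q.*2)%N -> fus a 0 x%:Z = 1.
  move=> x_bnd; rewrite /= divz_small; last by lia.
  have -> : - x%:Z = (-1) * q.*2%:Z + (q.*2%:Z - x%:Z) by lia.
  by rewrite divzMDl // divz_small; lia.
have flat_q (m : nat) : (m <= a)%N -> fus a 1 (q%:Z - m%:Z) = q%:Z.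
  elim: m => [|m IH] ma; first by rewrite subr0 fus_q expn1.
  have IHm := IH (ltnW ma).
  have := sum_window_step (fus a 0) (q%:Z - m.+1%:Z); rewrite -!fusS.
  have -> : q%:Z - m.+1%:Z + 1 = q%:Z - m%:Z by lia.
  have -> : q%:Z - m.+1%:Z + a%:Z + 1 = (q + a - m)%N%:Z by lia.
  have -> : q%:Z - m.+1%:Z - a%:Z = (a - m)%N%:Z by lia.
  by rewrite !fus0_1; lia.
move=> ra; have := flat_q (a - r)%N (leq_subr _ _); rewrite /psi expn0.
have -> : q%:Z - (a - r)%N%:Z = a%:Z + 1 + r%:Z by lia.
by move=> ->; lia.
Qed.

Lemma psi1_right (r : nat) : (r <= a)%N ->
  psi 1 (a%:Z + 1 + r%:Z) = psi 1 (a%:Z + 1) - r%:Z * (r%:Z + 1).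
Proof.
elim: r => [|r IH] ra; first by rewrite addr0 mul0r subr0.
have := psi_step 0 (a%:Z + 1 + r%:Z).
have -> : a%:Z + 1 + r%:Z + a%:Z + 1 = r.+1%:Z + q%:Z by lia.
have -> : a%:Z + 1 + r%:Z + 1 = a%:Z + 1 + r.+1%:Z by lia.
rewrite psi_antiperiod -(psi_sym 0 r.+1%:Z).
have -> : q%:Z - r.+1%:Z = a%:Z + 1 + (a - r.+1)%N%:Z by lia.
by rewrite psi0_right ?leq_subr // IH ?(ltnW ra) //; lia.
Qed.

(** The centre q/2 of [psi_sym] is a half-integer; a + 1 is one of the two nearest integers, at
    which psi takes equal values. *)
Definition wmid j := psi j a.+1%:Z.

(* Expansion in the polynomials 'C(r + i, i.*2), which are even about r = -1/2. *)
Definition taylor (w : nat -> int) (t : int) e J r : int :=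
  \sum_(i < J.+1) (-4) ^+ i * 'C(r + i, i.*2)%:Z * w (J - i)%N
  + t * (-4) ^+ J * 'C(r + J + e, J.*2 + e.+1)%:Z.

Lemma pascal_step2 n m (c : int) : (-4) * c * 'C(n.+2, m.+2)%:Z
  = 2 * ((-4) * c * 'C(n.+1, m.+2)%:Z) - (-4) * c * 'C(n, m.+2)%:Z
    - 4 * (c * 'C(n, m)%:Z).
Proof.
have -> : 'C(n.+2, m.+2)%:Z
    = 2 * 'C(n.+1, m.+2)%:Z + 'C(n, m)%:Z - 'C(n, m.+2)%:Z.
  by rewrite !binS; lia.
by ring.
Qed.

Lemma taylor_step2 w t e J r : taylor w t e J.+1 r.+2
  = 2 * taylor w t e J.+1 r.+1 - taylor w t e J.+1 r - 4 * taylor w t e J r.+1.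
Proof.
pose S r' := \sum_(i < J.+1) (-4) ^+ i.+1 * 'C(r' + i.+1, i.+1.*2)%:Z * w (J - i)%N.
pose E r' := t * (-4) ^+ J.+1 * 'C(r' + J.+1 + e, J.+1.*2 + e.+1)%:Z.
have taylorE r' : taylor w t e J.+1 r' = w J.+1 + S r' + E r'.
  by rewrite /taylor big_ord_recl /= addn0 bin0 !mul1r.
have E2 : E r.+2 = 2 * E r.+1 - E r
    - 4 * (t * (-4) ^+ J * 'C(r.+1 + J + e, J.*2 + e.+1)%:Z).
  rewrite /E exprS; have := pascal_step2 (r + J + e).+1 (J.*2 + e).+1 (t * (-4) ^+ J).
  have cE (x : int) : t * (-4 * (-4) ^+ J) * x = -4 * (t * (-4) ^+ J) * x by ring.
  by rewrite !cE !addSn !addnS !addSn.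
have S2 : S r.+2 = 2 * S r.+1 - S r
    - 4 * \sum_(i < J.+1) (-4) ^+ i * 'C(r.+1 + i, i.*2)%:Z * w (J - i)%N.
  rewrite /S !mulr_sumr -!sumrB; apply: eq_bigr => i _.
  rewrite !addSn !addnS doubleS exprS.
  by rewrite (pascal_step2 (r + i).+1 i.*2 ((-4) ^+ i)); ring.
rewrite !taylorE E2 S2 /taylor; ring.
Qed.

Lemma taylor_at0 w t e J : taylor w t e J.+1 0 = w J.+1.
Proof.
rewrite /taylor; have -> : 'C(0 + J.+1 + e, J.+1.*2 + e.+1) = 0%N.
  by rewrite bin_small //; lia.
rewrite big_ord_recl /= bin0 !mul1r.
rewrite mulr0 addr0 big1 ?addr0 // => i _; rewrite bin_small ?mulr0 ?mul0r //.
by rewrite /bump /=; lia.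
Qed.

Lemma taylor_at1 w t e J : taylor w t e J.+1 1 = w J.+1 - 4 * w J.
Proof.
rewrite /taylor; have -> : 'C(1 + J.+1 + e, J.+1.*2 + e.+1) = 0%N.
  by rewrite bin_small //; lia.
rewrite !big_ord_recl /= bin0 !mul1r.
rewrite mulr0 addr0 big1 => [|i _]; last first.
  by rewrite bin_small ?mulr0 ?mul0r // /bump /=; lia.
by rewrite addr0 subn1 /= expr1 mulr1 mulNr.
Qed.

(** Both sides satisfy the same second-order recurrence in r, by [psi_step2] and [taylor_step2], and
    agree at r = 0 and r = 1. The base J = 0 is [psi0_right] or [psi1_right], according to the
    parity e, and fixes the coefficient -(e + 1) of the last term. *)
Lemma psi_taylor e J (r : nat) : (e <= 1)%N -> (r <= a)%N ->
  psi (J.*2 + e) (a%:Z + 1 + r%:Z)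
    = taylor (fun i => wmid (i.*2 + e)) (- (e.+1)%:Z) e J r.
Proof.
move=> e1; elim: J r => [|J IH] r ra.
  rewrite /taylor big_ord_recl big_ord0 /= !addn0 add0n !bin0 !expr0 addr0 !mul1r mulr1.
  rewrite /wmid; have -> : a.+1%:Z = a%:Z + 1 by lia.
  case: e e1 => [|[|//]] _.
    rewrite addn0 bin1 psi0_right // -[X in psi 0 X]addr0 (psi0_right (leq0n a)).
    by lia.
  rewrite psi1_right // addn1 bin2 /=; have := mul_bin_diag r.+1 1.
  have -> : (r.+1 * r)./2 = 'C(r.+1, 2) by rewrite bin2.
  by rewrite bin1; lia.
have psiE r' : psi (J.+1.*2 + e) (a%:Z + 1 + r'.+2%:Z)
    = 2 * psi (J.+1.*2 + e) (a%:Z + 1 + r'.+1%:Z) - psi (J.+1.*2 + e) (a%:Z + 1 + r'%:Z)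
      - 4 * psi (J.*2 + e) (a%:Z + 1 + r'.+1%:Z).
  have := psi_step2 (J.*2 + e) (a%:Z + 1 + r'%:Z).
  have -> : a%:Z + 1 + r'%:Z + 2 = a%:Z + 1 + r'.+2%:Z by lia.
  by have -> : a%:Z + 1 + r'%:Z + 1 = a%:Z + 1 + r'.+1%:Z by lia.
have psi_at0 j : psi j (a%:Z + 1) = wmid j by rewrite /wmid; congr (psi _ _); lia.
elim/ltn_ind: r ra => -[|[|r]] IHr ra.
- by rewrite addr0 psi_at0 taylor_at0.
- have := psi_step2 (J.*2 + e) a%:Z.
  have -> : psi (J.*2 + e).+2 a%:Z = wmid (J.*2 + e).+2.
    by rewrite -psi_sym /wmid; congr (psi _ _); lia.
  have -> : a%:Z + 2 = a%:Z + 1 + 1%:Z by lia.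
  rewrite taylor_at1 !psi_at0 => ->; ring.
- by rewrite psiE !IHr ?(ltnW ra) // ?(ltnW (ltnW ra)) // IH ?(ltnW ra) // taylor_step2.
Qed.

(** At r = a the expansion gives psi at a + 1 + a = q, where it vanishes. *)
Lemma wmid_rec e J : (e <= 1)%N ->
  \sum_(i < J.+1) (-4) ^+ i * 'C(a + i, i.*2)%:Z * wmid ((J - i).*2 + e)
    = e.+1%:Z * (-4) ^+ J * 'C(a + J + e, J.*2 + e.+1)%:Z.
Proof.
move=> e1; have := psi_taylor J e1 (leqnn a).
have -> : a%:Z + 1 + a%:Z = q%:Z by lia.
rewrite psi_q /taylor; set S := \sum_(i < _) _ => E.
suff : S - e.+1%:Z * (-4) ^+ J * 'C(a + J + e, J.*2 + e.+1)%:Z = 0 by lia.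
by rewrite [RHS]E; ring.
Qed.

Lemma fus_mid j : fus a j.+1 a.+1%:Z = wmid j + a.+1%:Z * (q ^ j)%N%:Z.
Proof. by rewrite /wmid /psi subrK. Qed.

Lemma fus_one j : fus a j.+2 1 = (q ^ j.+1)%N%:Z + 2 * wmid j.
Proof.
have := psi_step j 0; rewrite psi0r subr0 !add0r.
have -> : a%:Z + 1 = a.+1%:Z by lia.
by rewrite -/(wmid j) => <-; rewrite /psi; ring.
Qed.
End FusionDifferences.
(** * Perturbation of the recurrence *)

Section Perturbation.
Variable F : realFieldType.
Implicit Types (C t : F).

(** Taylor coefficients of cos without their signs. *)
Definition cosc (i : nat) : F := (i.*2)`!%:R^-1.
(* Bounds q (1 - chat i) for q >= 3, chat i being the ratio of the i-th
   coefficients of the two recurrences. *)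
Definition defect (i : nat) : F := if i == 1%N then 3^-1 else i%:R ^+ 2.

Lemma cosc_gt0 i : 0 < cosc i.
Proof. by rewrite invr_gt0 ltr0n fact_gt0. Qed.

Lemma cosc_ge0 i : 0 <= cosc i. Proof. exact/ltW/cosc_gt0. Qed.

Lemma cosc0 : cosc 0 = 1. Proof. by rewrite /cosc invr1. Qed.

Lemma defect_ge0 i : 0 <= defect i.
Proof. by rewrite /defect; case: ifP => _; rewrite ?exprn_ge0 ?invr_ge0. Qed.

(** The constant 3 bounds the [C] of [cosc_sum]. The left sides at least halve from one index to the
    next, and the majorants sum to 1/24. *)
Lemma cosc_tail n : cosc n.+3 * (3 + n.+3%:R ^+ 2) <= 48^-1 * 2^-1 ^+ n.
Proof.
elim: n => [|n IH]; first by rewrite /cosc /= (_ : 6`! = 720)%N //; lra.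
have -> : cosc n.+4 = cosc n.+3 / ((2 * n%:R + 7) * (2 * n%:R + 8)).
  rewrite /cosc 2!factS !natrM !invfM.
  have -> : (n.+3.*2.+1.+1)%:R = 2 * n%:R + 8 :> F by rewrite -natrM -natrD; congr _%:R; lia.
  have -> : (n.+3.*2.+1)%:R = 2 * n%:R + 7 :> F by rewrite -natrM -natrD; congr _%:R; lia.
  by ring.
have n0 : 0 <= n%:R :> F by [].
have E3 : n.+3%:R = n%:R + 3 :> F by rewrite -addn3 natrD.
have E4 : n.+4%:R = n%:R + 4 :> F by rewrite -addn4 natrD.
have g0 := cosc_gt0 n.+3; move: IH g0; rewrite [2^-1 ^+ n.+1]exprS E3 E4.
move: (cosc n.+3) (n%:R : F) n0 (2^-1 ^+ n : F) => X m m0 Y IH X0.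
suff : X / ((2 * m + 7) * (2 * m + 8)) * (3 + (m + 4) ^+ 2)
    <= 2^-1 * (X * (3 + (m + 3) ^+ 2)).
  by move=> h; apply: (le_trans h); rewrite [leRHS]mulrCA ler_pM2l ?invr_gt0 ?ltr0n.
rewrite mulrAC ler_pdivrMr; last by nra.
have -> : 2^-1 * (X * (3 + (m + 3) ^+ 2)) * ((2 * m + 7) * (2 * m + 8))
  = X * (2^-1 * (3 + (m + 3) ^+ 2) * ((2 * m + 7) * (2 * m + 8))) by ring.
rewrite ler_pM2l //; nra.
Qed.

(** The first two terms are (C + t/3)/2 and (C + 4t)/24, adding up to 13C/24 + t/3; the rest is
    [cosc_tail]. *)
Lemma cosc_sum C t J : 0 <= C <= 3 -> 0 <= t <= 1 ->
  \sum_(i < J) cosc i.+1 * (C + t * defect i.+1)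
    <= 13 * C / 24 + t / 3 + 24^-1.
Proof.
move=> C_bnd t_bnd; pose G i := cosc i.+1 * (C + t * defect i.+1).
have G0 i : 0 <= G i.
  by rewrite mulr_ge0 ?cosc_ge0 // addr_ge0 ?mulr_ge0 ?defect_ge0 //; lra.
have mono : \sum_(i < J) G i <= \sum_(i < J.+2) G i.
  by rewrite !big_ord_recr /= -addrA lerDl addr_ge0.
apply: (le_trans mono).
suff bnd n : \sum_(i < n.+2) G i
    <= 13 * C / 24 + t / 3 + 24^-1 * (1 - 2^-1 ^+ n).
  have : 0 <= 2^-1 ^+ J :> F by rewrite exprn_ge0 // invr_ge0 ler0n.
  by move: (bnd J); lra.
elim: n => [|n IH].
  rewrite big_ord_recr big_ord1 /G /cosc /defect /=.
  rewrite (_ : 2`! = 2)%N // (_ : 4`! = 24)%N //; lra.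
rewrite big_ord_recr /=; have := cosc_tail n.
have : G n.+2 <= cosc n.+3 * (3 + n.+3%:R ^+ 2).
  rewrite ler_pM2l ?cosc_gt0 // /defect /=.
  have : 0 <= n.+3%:R ^+ 2 :> F by apply: exprn_ge0.
  move: (n.+3%:R ^+ 2) => s s0; nra.
rewrite [2^-1 ^+ n.+1]exprS; move: IH.
move: (\sum_(i < n.+2) G i) (G n.+2) (2^-1 ^+ n : F) (cosc _ * _) => s1 s2 s3 s4.
lra.
Qed.

(** Induction on J. The bound 13C/24 + 3/8 is [cosc_sum] at t = 1, collecting the errors of earlier
    values and of the coefficients; Rr is the error of the right-hand side, and the condition on C
    closes the induction. *)
Lemma perturb_bound (Q C Rr : F) (c x y rho sig : nat -> F) :
  0 < Q -> 0 <= C <= 3 -> 13 * C / 24 + 3 / 8 + Rr <= C ->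
  c 0 = 1 -> (forall i, 0 <= c i <= cosc i) ->
  (forall i, cosc i - c i <= cosc i * (defect i / Q)) ->
  (forall J, \sum_(i < J.+1) (-1) ^+ i * c i * x (J - i)%N = rho J) ->
  (forall J, \sum_(i < J.+1) (-1) ^+ i * cosc i * y (J - i)%N = sig J) ->
  (forall J, `|rho J - sig J| <= Rr / Q) -> (forall J, `|y J| <= 1) ->
  forall J, `|x J - y J| <= C / Q.
Proof.
move=> Q0 C_bnd CR c0 c_bnd c_def Hx Hy Hrs y1; elim/ltn_ind => J IH.
have := Hx J; have := Hy J; rewrite !big_ord_recl /= subn0 c0 cosc0 !mul1r.
set Sy := \sum_(i < J) _; set Sx := \sum_(i < J) _ => Ey Ex.
have -> : x J - y J = (rho J - sig J) - (Sx - Sy) by rewrite -Ex -Ey; ring.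
have S_bnd : `|Sx - Sy| <= (13 * C / 24 + 3 / 8) / Q.
  have := cosc_sum (t := 1) J C_bnd; rewrite ler01 lexx => /(_ isT) sum_bnd.
  have -> : 13 * C / 24 + 3 / 8 = 13 * C / 24 + 1 / 3 + 24^-1 by field.
  apply: le_trans (ler_wpM2r _ sum_bnd); last by rewrite invr_ge0 ltW.
  rewrite mulr_suml /Sx /Sy -sumrB; apply: (le_trans (ler_norm_sum _ _ _)).
  apply: ler_sum => i _; have lt_iJ := ltn_ord i.
  rewrite /bump /= add1n.
  set s := (-1) ^+ _; set xi := x _; set yi := y _.
  have -> : s * c i.+1 * xi - s * cosc i.+1 * yi
    = s * (c i.+1 * (xi - yi) - (cosc i.+1 - c i.+1) * yi) by ring.
  rewrite normrM normrX normrN1 expr1n mul1r mul1r.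
  apply: (le_trans (ler_normB _ _)); rewrite !normrM.
  have /andP[ci0 ci1] := c_bnd i.+1; have cd := c_def i.+1.
  have lt_JiJ : (J - i.+1 < J)%N by rewrite ltn_subrL (leq_ltn_trans _ lt_iJ).
  have IHi : `|xi - yi| <= C / Q := IH _ lt_JiJ.
  have gc0 : 0 <= cosc i.+1 - c i.+1 by rewrite subr_ge0.
  rewrite (ger0_norm ci0) (ger0_norm gc0).
  rewrite [leRHS](_ : _ = cosc i.+1 * (C / Q) + cosc i.+1 * (defect i.+1 / Q)).
    apply: lerD; first by rewrite ler_pM ?normr_ge0.
    by apply: le_trans cd; apply: ler_piMr; rewrite ?subr_ge0 ?y1.
  by ring.
apply: (le_trans (ler_normB _ _)); apply: (le_trans (lerD (Hrs J) S_bnd)).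
by rewrite -mulrDl ler_pM2r ?invr_gt0 // addrC.
Qed.

(** With C = 1 and t = 0, [cosc_sum] bounds the contribution of earlier values by 7/12, leaving 5/12
    for the right-hand side. *)
Lemma solution_bound (y sig : nat -> F) :
  (forall J, \sum_(i < J.+1) (-1) ^+ i * cosc i * y (J - i)%N = sig J) ->
  `|sig 0| <= 1 -> (forall J, `|sig J.+1| <= 5 / 12) ->
  forall J, `|y J| <= 1.
Proof.
move=> Hy s0 sS; elim/ltn_ind => J IH.
have := Hy J; rewrite big_ord_recl /= subn0 cosc0 !mul1r.
case: J IH => [|J] IH; first by rewrite big_ord0 addr0 => ->.
set S := \sum_(i < _) _ => E; have -> : y J.+1 = sig J.+1 - S by rewrite -E addrK.
have S_bnd : `|S| <= 7 / 12.
  have := cosc_sum (C := 1) (t := 0) J.+1; rewrite ler01 lexx ler1n => /(_ isT isT) le.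
  have -> : 7 / 12 = 13 * 1 / 24 + 0 / 3 + 24^-1 :> F by field.
  apply: le_trans le; apply: (le_trans (ler_norm_sum _ _ _)).
  apply: ler_sum => i _; rewrite /bump /= add1n mul0r addr0.
  rewrite !normrM normrX normrN1 expr1n mul1r (ger0_norm (cosc_ge0 _)).
  by rewrite ler_wpM2l ?cosc_ge0 // IH //; lia.
apply: (le_trans (ler_normB _ _)); have := sS J; lra.
Qed.
End Perturbation.

(** * Distance of the normalised central values from the m_j *)

Section ScaledDeviation.
Variables (F : realFieldType) (a : nat).
Local Notation q := (a.*2.+1).
Local Notation Q := (q%:R : F).

(** The normalised coefficient 4^i 'C(a + i, i.*2) / q^(2i) of [wmid_rec] is [chat i] / (2i)!. *)
Definition chat i : F := (4 ^ i * (a + i) ^_ i.*2)%N%:R / Q ^+ i.*2.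
Definition cq i : F := chat i * cosc F i.
Definition dhat J : F :=
  (2 * 4 ^ J * (a + J) ^_ J.*2.+1)%N%:R / Q ^+ J.*2.+1.
(* The analogue at level q of m_j: fus N 1 = q^(N-1) (1 + dev (N-1)). *)
Definition dev j : F :=
  if j is j'.+1 then 2 * (wmid a j')%:~R / Q ^+ j else 1.

Lemma Q_gt0 : 0 < Q. Proof. by rewrite ltr0n. Qed.

Lemma Q_neq0 : Q != 0. Proof. exact/lt0r_neq0/Q_gt0. Qed.

Lemma Q_double : Q = 2 * a%:R + 1.
Proof. by rewrite -natrM natr1; congr _%:R; lia. Qed.

Lemma chat0 : chat 0 = 1.
Proof. by rewrite /chat expn0 ffactn0 mul1n divr1. Qed.

Lemma chat_large i : (a < i)%N -> chat i = 0.
Proof. by move=> ai; rewrite /chat ffact_small ?muln0 ?mul0r //; lia. Qed.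

Lemma chatS i : (i <= a)%N -> chat i.+1 = chat i * (1 - ((2 * i%:R + 1) / Q) ^+ 2).
Proof.
move=> ia; rewrite /chat addnS doubleS ffactSS ffactnSr !exprS.
have -> : (a + i - i.*2 = a - i)%N by lia.
have -> : (4 ^ i.+1 * ((a + i).+1 * ((a + i) ^_ i.*2 * (a - i)))
  = 4 ^ i * (a + i) ^_ i.*2 * (4 * ((a + i).+1 * (a - i))))%N by rewrite expnS; ring.
rewrite natrM; have -> : (4 * ((a + i).+1 * (a - i)))%N%:R
  = Q ^+ 2 - (2 * i%:R + 1) ^+ 2 :> F.
  rewrite !natrM.
  have -> : (a + i).+1%:R = a%:R + i%:R + 1 :> F by rewrite -natrD natr1.
  by rewrite Q_double natrB //; ring.
have := Q_neq0; move: Q => y y0.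
have yi : y ^+ i.*2 != 0 by rewrite expf_neq0.
by field; rewrite y0 yi.
Qed.

(** For i <= a + 1, [chat i] is the product over j < i of 1 - ((2j+1)/q)^2, with factors in [0, 1]
    and the factor at j = a equal to 0. The odd numbers below 2i add up to i^2. *)
Lemma chat_bound i : 0 <= chat i <= 1 /\ 1 - chat i <= i%:R ^+ 2 / Q.
Proof.
elim: i => [|i [IH01 IH]].
  by rewrite chat0 subrr ler01 lexx mulr_ge0 ?exprn_ge0 ?invr_ge0 ?ler0n.
have Q0 := Q_gt0.
have QI : i.+1%:R ^+ 2 / Q = i%:R ^+ 2 / Q + (2 * i%:R + 1) / Q.
  by rewrite -(natr1 i) -mulrDl; congr (_ / _); ring.
rewrite QI; have i0 : 0 <= (2 * i%:R + 1) / Q.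
  by rewrite divr_ge0 ?addr_ge0 ?mulr_ge0 ?ler0n.
have [ai|ia] := ltnP a i.
  have := chat_large (leqW ai); have := chat_large ai.
  move: IH => /[swap] -> + ->; move: i0.
  by move: (_ / Q) (_ / Q) => x y; split; lra.
rewrite (chatS ia).
have i1 : (2 * i%:R + 1) / Q <= 1.
  rewrite ler_pdivrMr // mul1r -natrM natr1 ler_nat; lia.
move: ((2 * i%:R + 1) / Q) (chat i) IH01 IH i0 i1 => x c c01 cI x0 x1.
have x2 : 0 <= x ^+ 2 <= x by nra.
move: (_ / Q) cI => d cI; move: (x ^+ 2) x2 => y y_bnd.
split; last by nra.
by apply/andP; split; nra.
Qed.

Lemma cq_bound i : 0 <= cq i <= cosc F i.
Proof.
have [c01 _] := chat_bound i; have := cosc_gt0 F i; rewrite /cq => g0.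
by apply/andP; split; nra.
Qed.

Hypothesis a_gt0 : (0 < a)%N.

(** For i = 1 the sharper constant comes from 1 - [chat 1] = 1/q^2 and q >= 3. *)
Lemma cq_defect i : cosc F i - cq i <= cosc F i * (defect F i / Q).
Proof.
have Q0 := Q_gt0.
have -> : cosc F i - cq i = cosc F i * (1 - chat i) by rewrite /cq; ring.
rewrite ler_wpM2l ?cosc_ge0 //; rewrite /defect; case: eqP => [->|_]; last first.
  by have [] := chat_bound i.
rewrite (chatS (leq0n a)) chat0.
have -> : 1 - 1 * (1 - ((2 * 0%:R + 1) / Q) ^+ 2) = Q^-1 / Q.
  by rewrite mulr0 add0r !mul1r; ring.
rewrite ler_pM2r ?invr_gt0 // lef_pV2 ?posrE ?ltr0n // ler_nat; lia.
Qed.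

Lemma dhat_chat J : dhat J = chat J * (2 * (a - J)%N%:R / Q).
Proof.
rewrite /dhat /chat ffactnSr; have -> : (a + J - J.*2 = a - J)%N by lia.
have -> : (2 * 4 ^ J * ((a + J) ^_ J.*2 * (a - J))
  = 4 ^ J * (a + J) ^_ J.*2 * (2 * (a - J)))%N by ring.
rewrite [in LHS]natrM exprS [(2 * _)%N%:R]natrM.
have := Q_neq0; move: Q => y y0.
have yi : y ^+ J.*2 != 0 by rewrite expf_neq0.
by field; rewrite y0 yi.
Qed.

Lemma dhat_bound J : `|dhat J - 1| <= J.+1%:R ^+ 2 / Q.
Proof.
have Q0 := Q_gt0; have [c01 cJ] := chat_bound J; rewrite dhat_chat.
have QI : J.+1%:R ^+ 2 / Q = J%:R ^+ 2 / Q + (2 * J%:R + 1) / Q.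
  by rewrite -(natr1 J) -mulrDl; congr (_ / _); ring.
have J0 : 0 <= (2 * J%:R + 1) / Q.
  by rewrite divr_ge0 ?addr_ge0 ?mulr_ge0 ?ler0n.
rewrite QI; have [aJ|Ja] := ltnP a J.
  move: cJ; rewrite (chat_large aJ) mul0r sub0r normrN1; move: J0.
  by move: (_ / Q) (_ / Q) => x y; lra.
have -> : 2 * (a - J)%N%:R / Q = 1 - (2 * J%:R + 1) / Q.
  have -> : 2 * (a - J)%N%:R = Q - (2 * J%:R + 1).
    by rewrite Q_double natrB //; ring.
  by rewrite mulrBl divff ?Q_neq0.
have J1 : (2 * J%:R + 1) / Q <= 1.
  rewrite ler_pdivrMr // mul1r -natrM natr1 ler_nat; lia.
move: ((2 * J%:R + 1) / Q) (chat J) c01 cJ J0 J1 => x c c01 cI x0 x1.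
move: (_ / Q) cI => d cI; rewrite distrC ger0_norm; nra.
Qed.

Lemma dev_rec e J : (e <= 1)%N ->
  \sum_(i < J.+1) (-1) ^+ i * cq i * dev ((J - i).*2 + e).+1
    = (-1) ^+ J * ((2 * e.+1 * 4 ^ J * (a + J + e) ^_ (J.*2 + e.+1))%N%:R
      / Q ^+ (J.*2 + e.+1) / (J.*2 + e.+1)`!%:R).
Proof.
move=> e1; have := congr1 (fun z : int => z%:~R * (2 / Q ^+ (J.*2 + e.+1))) (wmid_rec a J e1).
have binE n m : 'C(n, m)%:R = (n ^_ m)%:R / m`!%:R :> F.
  by rewrite -bin_ffact natrM mulfK // pnatr_eq0 -lt0n fact_gt0.
have N4 i : ((-4) ^+ i)%:~R = (-1) ^+ i * (4 ^ i)%N%:R :> F.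
  by rewrite rmorphXn /= natrX -exprMn; congr (_ ^+ _); rewrite mulN1r.
rewrite rmorph_sum mulr_suml => E.
transitivity (\sum_(i < J.+1) ((-4) ^+ i * 'C(a + i, i.*2)%:Z
    * wmid a ((J - i).*2 + e))%:~R * (2 / Q ^+ (J.*2 + e.+1))); last first.
  rewrite E !rmorphM /= N4 -!pmulrn binE !natrM.
  by ring.
apply: eq_bigr => i _; rewrite !rmorphM /= N4 -!pmulrn binE /cq /chat /cosc.
have -> : Q ^+ (J.*2 + e.+1) = Q ^+ i.*2 * Q ^+ ((J - i).*2 + e).+1.
  by rewrite -exprD; congr (_ ^+ _); have := ltn_ord i; lia.
rewrite !natrM /=; have := Q_neq0; move: Q => y y0.
have Q1 : y ^+ i.*2 != 0 by rewrite expf_neq0.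
have Q2 : y ^+ ((J - i).*2 + e).+1 != 0 by rewrite expf_neq0.
have f0 : (i.*2)`!%:R != 0 :> F by rewrite pnatr_eq0 -lt0n fact_gt0.
by field; rewrite Q1 Q2 f0.
Qed.

Lemma dev_odd_rec J :
  \sum_(i < J.+1) (-1) ^+ i * cq i * dev (J - i).*2.+1
    = (-1) ^+ J * dhat J / (J.*2.+1)`!%:R.
Proof.
rewrite -[RHS]mulrA /dhat.
have := dev_rec J (leq0n 1); rewrite !addn0 addn1 muln1 => <-.
by apply: eq_bigr => i _; rewrite addn0.
Qed.

(** [dev 0] = 1 is not a central value: the right-hand side of [dev_rec] for e = 1 is exactly the
    term it contributes, with opposite sign. *)
Lemma dev_even_rec J :
  \sum_(i < J.+1) (-1) ^+ i * cq i * dev (J - i).*2 = (J == 0%N)%:R.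
Proof.
case: J => [|J]; first by rewrite big_ord1 /= /cq chat0 cosc0 !mul1r.
rewrite big_ord_recr /= subnn mulr1.
have -> : \sum_(i < J.+1) (-1) ^+ i * cq i * dev (J.+1 - i).*2
    = (-1) ^+ J * cq J.+1.
  transitivity (\sum_(i < J.+1) (-1) ^+ i * cq i * dev ((J - i).*2 + 1).+1).
    apply: eq_bigr => i _; congr (_ * dev _); have := ltn_ord i; lia.
  rewrite dev_rec // /cq /chat /cosc addn1.
  have -> : (J.*2 + 2 = J.+1.*2)%N by lia.
  by rewrite expnS addnS.
by rewrite exprS mulN1r mulNr addrN.
Qed.

Variable m : nat -> F.
Hypothesis m_even : forall J,
  \sum_(i < J.+1) (-1) ^+ i * cosc F i * m (J - i).*2 = (J == 0%N)%:R.
Hypothesis m_odd : forall J,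
  \sum_(i < J.+1) (-1) ^+ i * cosc F i * m (J - i).*2.+1
    = (-1) ^+ J / (J.*2.+1)`!%:R.

Lemma cq0 : cq 0 = 1. Proof. by rewrite /cq chat0 cosc0 mulr1. Qed.

(** The right-hand sides of the two recurrences agree, so Rr = 0 and C = 1 suffices. *)
Lemma dev_even_close J : `|dev J.*2 - m J.*2| <= 1 / Q.
Proof.
apply: (perturb_bound (Rr := 0) (x := fun J => dev J.*2) (y := fun J => m J.*2)
  Q_gt0 _ _ cq0 cq_bound cq_defect dev_even_rec m_even); try lra.
  by move=> i; rewrite subrr normr0 mul0r.
apply: (solution_bound m_even) => [|i]; rewrite ?normr1 ?normr0 //; lra.
Qed.

Lemma fact_odd_ge J : (J.+1 ^ 2 <= (J.*2.+1)`!)%N.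
Proof.
elim: J => [|J IH] //; rewrite doubleS factS factS mulnA.
apply: (@leq_trans (6 * J.+1 ^ 2)); first by rewrite -!mulnn; nia.
by apply: leq_mul IH; nia.
Qed.

(** The right-hand sides differ by at most (J+1)^2 / (q (2J+1)!) <= 1/q, so Rr = 1, and C = 3 meets
    the condition with equality. *)
Lemma dev_odd_close J : `|dev J.*2.+1 - m J.*2.+1| <= 3 / Q.
Proof.
have Q0 := Q_gt0.
have f0 i : 0 < (i.*2.+1)`!%:R :> F by rewrite ltr0n fact_gt0.
apply: (perturb_bound (Rr := 1) (x := fun J => dev J.*2.+1)
  (y := fun J => m J.*2.+1) Q0 _ _ cq0 cq_bound cq_defect dev_odd_rec m_odd); try lra.
  move=> i; have -> : (-1) ^+ i * dhat i / (i.*2.+1)`!%:R - (-1) ^+ i / (i.*2.+1)`!%:R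
    = (-1) ^+ i * ((dhat i - 1) / (i.*2.+1)`!%:R) by ring.
  rewrite normrM normrX normrN1 expr1n mul1r normrM (gtr0_norm (x := _^-1)) ?invr_gt0 //.
  rewrite mul1r ler_pdivrMr //; apply: (le_trans (dhat_bound i)).
  rewrite mulrC ler_pM2l ?invr_gt0 // -natrX ler_nat.
  exact: fact_odd_ge.
apply: (solution_bound m_odd) => [|i].
  by rewrite mul1r invr1 normr1.
rewrite normrM normrX normrN1 expr1n mul1r gtr0_norm ?invr_gt0 //.
rewrite invf_ple ?posrE ?divr_gt0 ?ltr0n ?fact_gt0 //.
apply: (@le_trans _ _ 6); first by lra.
rewrite ler_nat doubleS factS factS mulnA -[6%N]muln1.
by apply: leq_mul; [nia|exact: fact_gt0].
Qed.
End ScaledDeviation.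

(** * Taylor coefficients of sec + tan *)

Section SecPlusTan.
Local Notation is_deriv := (@is_derive R_AbsRing R_NormedModule).
Implicit Types (x : R) (f g h : nat -> R -> R).

Let halfpi : R := Rdiv PI (IZR 2).
Let inI (x : R) : Prop := Rlt (Ropp halfpi) x /\ Rlt x halfpi.

(* f i is the i-th derivative of f 0 divided by i!. *)
Definition taylor_family f :=
  forall i x, inI x -> is_deriv (f i) x (i.+1%:R * f i.+1 x).

Lemma is_derive_bigsum (n : nat) (F : nat -> R -> R) (dF : nat -> R) x :
  (forall i, (i < n)%N -> is_deriv (F i) x (dF i)) ->
  is_deriv (fun t => \sum_(i < n) F i t) x (\sum_(i < n) dF i).
Proof.
elim: n => [|n IH] dFE.
  apply: (@is_derive_ext R_AbsRing R_NormedModule (fun=> 0)) => [t|]; first by rewrite big_ord0.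
  by rewrite big_ord0; exact: is_derive_const.
rewrite big_ord_recr /=.
apply: (@is_derive_ext R_AbsRing R_NormedModule
  (fun t => Rplus (\sum_(i < n) F i t) (F n t))) => [t|].
  by rewrite big_ord_recr.
apply: is_derive_plus; last exact: dFE.
by apply: IH => i lt_in; apply: dFE; apply: ltnW.
Qed.

(** Leibniz rule for divided derivatives, obtained by splitting n + 1 as i + (n + 1 - i). *)
Lemma taylor_family_mul f g : taylor_family f -> taylor_family g ->
  taylor_family (fun n x => \sum_(i < n.+1) f i x * g (n - i)%N x).
Proof.
move=> Tf Tg n x Ix.
pose d i := i.+1%:R * f i.+1 x * g (n - i)%N x
  + f i x * ((n - i).+1%:R * g (n - i).+1 x).
have -> : n.+1%:R * (\sum_(i < n.+2) f i x * g (n.+1 - i)%N x) = \sum_(i < n.+1) d i.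
  rewrite mulr_sumr.
  transitivity (\sum_(i < n.+2) (i%:R * f i x * g (n.+1 - i)%N x)
    + \sum_(i < n.+2) (f i x * ((n.+1 - i)%:R * g (n.+1 - i)%N x))).
    rewrite -big_split /=; apply: eq_bigr => i _.
    have -> : n.+1%:R = i%:R + (n.+1 - i)%:R :> R.
      by rewrite -natrD subnKC // -ltnS.
    by ring.
  rewrite big_ord_recl [X in _ + X]big_ord_recr /= !mul0r add0r subnn mul0r mulr0 addr0.
  rewrite -big_split /=; apply: eq_bigr => i _.
  by rewrite /d /bump /= add1n subSS subSn // -ltnS.
apply: (is_derive_bigsum (F := fun i t => f i t * g (n - i)%N t)) => i lt_in.
apply: is_derive_mult; [exact: Tf|exact: Tg|].
by move=> u v; apply: Rmult_comm.
Qed.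

Lemma taylor_family_unique f g : taylor_family f -> taylor_family g ->
  (forall x, inI x -> f 0%N x = g 0%N x) ->
  forall n x, inI x -> f n x = g n x.
Proof.
move=> Tf Tg fg0; elim=> [|n IH] x Ix; first exact: fg0.
have n0 : n.+1%:R != 0 :> R by rewrite pnatr_eq0.
apply: (mulfI n0).
rewrite -(is_derive_unique _ _ _ (Tf n x Ix)) -(is_derive_unique _ _ _ (Tg n x Ix)).
apply: Derive_ext_loc.
by apply: (locally_interval _ _ (Ropp halfpi) halfpi);
   [case: Ix|case: Ix|move=> t t1 t2; apply: IH].
Qed.

Fixpoint dcos (n : nat) (x : R) : R :=
  match n with 0 => cos x | 1 => Ropp (sin x) | n'.+2 => Ropp (dcos n' x) end.

Lemma is_derive_dcos n x : is_deriv (dcos n) x (dcos n.+1 x).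
Proof.
elim/ltn_ind: n => -[|[|n]] IH.
- exact: is_derive_cos.
- apply: is_derive_opp; exact: is_derive_sin.
- apply: is_derive_opp; exact: IH.
Qed.

Lemma taylor_family_div (F : nat -> R -> R) :
  (forall n x, inI x -> is_deriv (F n) x (F n.+1 x)) ->
  taylor_family (fun n x => F n x / n`!%:R).
Proof.
move=> dF n x Ix.
have -> : n.+1%:R * (F n.+1 x / n.+1`!%:R) = n`!%:R^-1 * F n.+1 x :> R.
  have n0 : n.+1%:R != 0 :> R by rewrite pnatr_eq0.
  have f0 : n`!%:R != 0 :> R by rewrite pnatr_eq0 -lt0n fact_gt0.
  rewrite factS natrM; move: (n.+1%:R) (n`!%:R) n0 f0 => y z y0 z0.
  by field; rewrite y0 z0.
apply: (@is_derive_ext R_AbsRing R_NormedModule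
  (fun t => Rmult (n`!%:R^-1) (F n t))) => [t|]; first by rewrite mulrC.
by apply: is_derive_scal; apply: dF.
Qed.

(** This Riccati equation for y = (1 + sin)/cos makes every derivative a polynomial in y, hence y
    smooth on the interval. *)
Lemma secplustan_deriv x : inI x ->
  is_deriv secplustan x ((1 + secplustan x ^+ 2) / 2).
Proof.
move=> [x1 x2]; have /RltP cx := cos_gt_0 x x1 x2.
have c0 : cos x != 0 by rewrite gt_eqF.
have cs : sin x ^+ 2 = 1 - cos x ^+ 2.
  by have := sin2_cos2 x; rewrite /Rsqr !RealsE => <-; ring.
have -> : (1 + secplustan x ^+ 2) / 2 = (1 + sin x) / cos x ^+ 2.
  rewrite /secplustan /tan !RealsE.
  have -> : (cos x)^-1 + sin x / cos x = (1 + sin x) / cos x by field.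
  rewrite expr_div_n sqrrD cs; field; exact: c0.
rewrite /secplustan /tan; auto_derive; first by have /eqP := c0; do ?split.
rewrite !RealsE.
transitivity ((cos x ^+ 2 + sin x + sin x ^+ 2) / cos x ^+ 2); first by field.
by rewrite cs; congr (_ / _); ring.
Qed.

Lemma is_derive_horner (P : {poly R}) x :
  is_deriv (fun t => P.[t]) x (P^`()).[x].
Proof.
elim/poly_ind: P => [|P c IH].
  apply: (@is_derive_ext R_AbsRing R_NormedModule (fun=> 0)) => [t|].
    by rewrite horner0.
  by rewrite deriv0 horner0; exact: is_derive_const.
apply: (@is_derive_ext R_AbsRing R_NormedModule
  (fun t => Rplus (Rmult P.[t] t) c)) => [t|]; first by rewrite !hornerE.
have -> : ((P * 'X + c%:P)^`()).[x] = Rplus (Rplus (Rmult (P^`()).[x] x) (Rmult P.[x] 1)) 0.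
  by rewrite derivD derivM derivX derivC !hornerE !RealsE.
apply: is_derive_plus; last exact: is_derive_const.
apply: is_derive_mult => //; last by move=> u v; apply: Rmult_comm.
exact: is_derive_id.
Qed.

Lemma secplustan_smooth n : exists P : {poly R},
  forall x, inI x -> Derive_n secplustan n x = P.[secplustan x].
Proof.
elim: n => [|n [P IH]]; first by exists 'X => x _; rewrite hornerX.
exists (P^`() * (2^-1)%:P * (1 + 'X ^+ 2)) => x Ix /=.
have dP : is_deriv (fun t => P.[secplustan t]) x
    (((1 + secplustan x ^+ 2) / 2) * (P^`()).[secplustan x]).
  apply: (is_derive_comp (fun t => P.[t]) secplustan); first exact: is_derive_horner.
  exact: secplustan_deriv.
have -> : (P^`() * (2^-1)%:P * (1 + 'X ^+ 2)).[secplustan x]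
  = ((1 + secplustan x ^+ 2) / 2) * (P^`()).[secplustan x].
  by rewrite !hornerE; ring.
rewrite -(is_derive_unique _ _ _ dP); apply: Derive_ext_loc.
by apply: (locally_interval _ _ (Ropp halfpi) halfpi);
   [case: Ix|case: Ix|move=> t t1 t2; apply: IH].
Qed.

Lemma secplustan_Derive_n n x : inI x ->
  is_deriv (Derive_n secplustan n) x (Derive_n secplustan n.+1 x).
Proof.
move=> Ix; apply: Derive_correct; have [P PE] := secplustan_smooth n.
apply: (ex_derive_ext_loc (fun t => P.[secplustan t])).
  by apply: (locally_interval _ _ (Ropp halfpi) halfpi);
    [case: Ix|case: Ix|move=> t t1 t2; rewrite PE].
apply: (ex_derive_comp (fun t => P.[t]) secplustan).
  by exists ((P^`()).[secplustan x]); apply: is_derive_horner.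
by exists ((1 + secplustan x ^+ 2) / 2); apply: secplustan_deriv.
Qed.

(* cos * (sec + tan) = 1 + sin, compared coefficientwise at 0. *)
Lemma secplustan_convolution n :
  \sum_(i < n.+1) dcos i 0 / i`!%:R * m_coef (n - i)%N
    = ((n == 0%N)%:R - dcos n.+1 0) / n`!%:R.
Proof.
have Tc := taylor_family_div (fun n x _ => is_derive_dcos n x).
have Ty := taylor_family_div secplustan_Derive_n.
(* [s n] is the n-th derivative of 1 + sin, as sin is minus the derivative of cos. *)
pose s (n : nat) (x : R) : R := (n == 0%N)%:R - dcos n.+1 x.
have Ts : taylor_family (fun n x => s n x / n`!%:R).
  apply: taylor_family_div => i x _; rewrite /s /= sub0r.
  have -> : - dcos i.+2 x = Rplus 0 (Ropp (dcos i.+2 x)) by rewrite Rplus_0_l.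
  apply: (@is_derive_ext R_AbsRing R_NormedModule
    (fun t => Rplus (i == 0%N)%:R (Ropp (dcos i.+1 t)))) => [t //|].
  apply: is_derive_plus; first exact: is_derive_const.
  by apply: is_derive_opp; apply: is_derive_dcos.
have pi0 : Rlt 0 halfpi by exact: PI2_RGT_0.
have I0 : inI 0 by split=> //; rewrite -Ropp_0; apply: Ropp_lt_contravar.
have := taylor_family_unique (taylor_family_mul Tc Ty) Ts _ n I0.
rewrite /m_coef => <-.
  apply: eq_bigr => i _; congr (_ * _); by rewrite !RealsE.
move=> x [x1 x2]; rewrite big_ord1 /s /= !divr1.
have /RltP cx := cos_gt_0 x x1 x2; have c0 : cos x != 0 by rewrite gt_eqF.
rewrite /secplustan /tan !RealsE opprK; field; exact: c0.
Qed.

Lemma dcos_at0 i : dcos i.*2 0 = (-1) ^+ i /\ dcos i.*2.+1 0 = 0.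
Proof.
elim: i => [|i [IH0 IH1]]; first by rewrite /= cos_0 sin_0 !RealsE ?oppr0.
have dS n : dcos n.+2 0 = - dcos n 0 by [].
by rewrite doubleS !dS IH0 IH1 exprS mulN1r oppr0.
Qed.

Local Arguments dcos : simpl never.

Lemma m_coef_even_rec J :
  \sum_(i < J.+1) (-1) ^+ i * cosc R i * m_coef (J - i).*2 = (J == 0%N)%:R.
Proof.
have := secplustan_convolution J.*2.
rewrite big_ord_recr (big_ord_double _
  (fun i => dcos i 0 / i`!%:R * m_coef (J.*2 - i)%N)) /=.
rewrite [X in _ + X + _]big1 => [|i _]; last by rewrite (dcos_at0 i).2 !mul0r.
rewrite (dcos_at0 J).2 subr0 addr0 double_eq0 => E.
transitivity ((J == 0%N)%:R / (J.*2)`!%:R : (R : realFieldType)); last first.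
  by case: (J) => [|i]; [exact: divr1|rewrite mul0r].
rewrite -E big_ord_recr /=; congr (_ + _); last by rewrite (dcos_at0 J).1 !subnn.
by apply: eq_bigr => i _; rewrite (dcos_at0 i).1 doubleB.
Qed.

Lemma m_coef_odd_rec J :
  \sum_(i < J.+1) (-1) ^+ i * cosc R i * m_coef (J - i).*2.+1
    = (-1) ^+ J / (J.*2.+1)`!%:R.
Proof.
have := secplustan_convolution J.*2.+1; rewrite -doubleS.
rewrite (big_ord_double _
  (fun i => dcos i 0 / i`!%:R * m_coef (J.*2.+1 - i)%N)) /=.
rewrite [X in _ + X]big1 => [|i _]; last by rewrite (dcos_at0 i).2 !mul0r.
rewrite (dcos_at0 J.+1).1 sub0r addr0 exprS mulN1r opprK => <-.
apply: eq_bigr => i _; rewrite (dcos_at0 i).1; congr (_ * m_coef _).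
by have := ltn_ord i; lia.
Qed.
End SecPlusTan.
(** * The Hilbert-Kunz multiplicity *)

Section HilbertKunz.
Variables (n p : nat) (k : fieldType) (a : nat).
Hypothesis p_char : p \in [pchar k].
Hypothesis p_odd : p = a.*2.+1.
Hypothesis a_gt0 : (0 < a)%N.
Local Notation len s := (\dim (lker (flat k 2 (p ^ s) n.+2))).
Local Notation RF := (R : realFieldType).
Local Notation P s := ((p ^ s)%N%:R : RF).

Definition hk_term s : RF := (len s)%:R / P s ^+ n.+1.

Lemma P_gt0 s : 0 < P s.
Proof. by rewrite ltr0n expn_gt0 p_odd. Qed.

Lemma hk_termS s : hk_term s <= hk_term s.+1.
Proof.
rewrite ler_pdivrMr ?exprn_gt0 ?P_gt0 //.
have -> : hk_term s.+1 * P s ^+ n.+1 = (len s.+1)%:R / p%:R ^+ n.+1.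
  have := P_gt0 s; have p0 : 0 < p%:R :> R by rewrite ltr0n p_odd.
  rewrite /hk_term expnSr natrM; move: (p%:R : RF) p0 (P s) => y y0 z z0.
  rewrite exprMn; field.
  by rewrite !expf_neq0 // gt_eqF.
rewrite ler_pdivlMr ?exprn_gt0 ?ltr0n ?p_odd // -p_odd -natrX -natrM ler_nat mulnC.
exact: lker_flat_expS.
Qed.

(** Since 2(a + 1) = p + 1, the linear part of [fus_mid] contributes 1 + 1/p, and the central value
    contributes [dev]. *)
Lemma hk_term_upper s : hk_term s.+1 <= 1 + dev R a n.+1 + p%:R^-1.
Proof.
have p0 : 0 < p%:R :> R by rewrite ltr0n p_odd.
rewrite ler_pdivrMr ?exprn_gt0 ?P_gt0 //.
have := lker_flat_upper p_char p_odd a_gt0 n.+1 s.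
rewrite -(ler_int R) -pmulrn => /le_trans; apply.
rewrite fus_mid /dev -p_odd; move: (wmid a n) => w.
rewrite 2!intrM intrD [(a.+1%:Z * _)%:~R]intrM -!pmulrn.
rewrite [(p ^ s.+1)%N]expnSr [(_ ^ s * _)%:R]natrM exprMn !natrX.
have Ea : a.+1%:R = (p%:R + 1) / 2 :> RF.
  by rewrite p_odd natr1 -doubleS -muln2 natrM mulfK ?pnatr_eq0.
have := P_gt0 s; rewrite natrX Ea; move: (p%:R : RF) p0 (w%:~R) => y y0 z z0.
rewrite le_eqVlt; apply/orP; left; apply/eqP.
rewrite [y ^+ n.+1]exprS; field.
by rewrite !expf_neq0 // gt_eqF.
Qed.

Lemma hk_term_lower s : (0 < s)%N ->
  exists2 b, (0 < b)%N /\ (p ^ s = b.*2.+1)%N & 1 + dev R b n.+1 <= hk_term s.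
Proof.
move=> s0; pose b := (p ^ s)./2.
have ps_odd : odd (p ^ s) by rewrite oddX p_odd /= odd_double orbT.
have b_eq : (p ^ s = b.*2.+1)%N by rewrite -[LHS]odd_double_half ps_odd.
have le_ps : (p <= p ^ s)%N by rewrite -{1}[p]expn1 leq_pexp2l // p_odd.
exists b; first by split=> //; lia.
rewrite ler_pdivlMr ?exprn_gt0 ?P_gt0 //.
have := fus1_le_lker n.+2 p_char b_eq; rewrite -(ler_int R) -pmulrn.
apply: le_trans; rewrite fus_one /dev -b_eq; move: (wmid b n) => w.
rewrite intrD [(2 * w)%:~R]intrM -!pmulrn [((_ ^ s) ^ _)%:R]natrX.
have := P_gt0 s; move: (P s) (w%:~R) => z y z0.
rewrite le_eqVlt; apply/orP; left; apply/eqP; field.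
by rewrite !expf_neq0 // gt_eqF.
Qed.

Lemma dev_close b : (0 < b)%N ->
  `|dev R b n.+1 - m_coef n.+1| <= (if odd n then 1 else 3) / b.*2.+1%:R.
Proof.
move=> b0; have [odd_n|even_n] := ifPn.
  have -> : n.+1 = n.+1./2.*2 by rewrite -[LHS]odd_double_half /= odd_n.
  exact: (@dev_even_close R b b0 m_coef m_coef_even_rec).
have -> : n.+1 = n./2.*2.+1 by rewrite -{1}[n]odd_double_half (negPf even_n).
exact: (@dev_odd_close R b b0 m_coef m_coef_odd_rec).
Qed.

Hypothesis n_ge3 : (3 <= n)%N.

Lemma hk_term_le s : hk_term s <= 1 + m_coef n.+1 + (2 * n - 4)%N%:R / p%:R.
Proof.
apply: (le_trans (hk_termS s)); apply: (le_trans (hk_term_upper s)).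
have := dev_close a_gt0; rewrite -p_odd ler_norml => /andP[_ dev_le].
have p0 : 0 < p%:R :> R by rewrite ltr0n p_odd.
(* Odd n requires 2 <= 2n - 4; even n is at least 4, so 4 <= 2n - 4. *)
have : (if odd n then 1 else 3) / p%:R + p%:R^-1 <= (2 * n - 4)%N%:R / p%:R :> R.
  rewrite -{2}[p%:R^-1]mul1r -mulrDl ler_pM2r ?invr_gt0 //.
  case: ifPn => odd_n; first by rewrite (_ : 1 + 1 = 2%:R) // ler_nat; lia.
  have : n != 3 by apply: contraNneq odd_n => ->.
  by move=> n3; rewrite (_ : 3 + 1 = 4%:R); [rewrite ler_nat; lia|ring].
move: (_ / p%:R) (_ / p%:R) dev_le => u v; lra.
Qed.

Lemma hk_term_ge s : (0 < s)%N -> 1 + m_coef n.+1 - 3 / P s <= hk_term s.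
Proof.
move=> /hk_term_lower[b [b0 b_eq]]; apply: le_trans.
have := dev_close b0; rewrite -b_eq ler_norml => /andP[dev_ge _].
have : (if odd n then 1 else 3) / P s <= 3 / P s.
  by rewrite ler_pM2r ?invr_gt0 ?P_gt0 //; case: ifP => _; rewrite ?ler_nat ?ler1n.
move: (_ / P s) (_ / P s) dev_ge => u v; lra.
Qed.

Lemma hk_limit : exists e : RF,
  [/\ is_lim_seq hk_term (Rbar.Finite e), 1 + m_coef n.+1 <= e
    & e <= 1 + m_coef n.+1 + (2 * n - 4)%N%:R / p%:R].
Proof.
have incr s : Rle (hk_term s) (hk_term s.+1) by apply/RleP/hk_termS.
have [e lim_e] : ex_finite_lim_seq hk_term.
  by apply: (ex_finite_lim_seq_incr _ _ incr) => s; apply/RleP/hk_term_le.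
exists e; split=> //.
(* Every term of the increasing sequence is at most its limit, so one term within eps suffices; p^s
   > s makes the error 3/p^s small. *)
- apply/ler_addgt0Pr => eps eps0.
  have [s s0 le_eps] : exists2 s, (0 < s)%N & 3 / P s <= eps.
    exists (Num.bound (3 / eps)).+1 => //.
    have le0 : 0 <= 3 / eps by rewrite divr_ge0 // ltW.
    have := archi_boundP le0; set b := Num.bound _ => lt_b.
    rewrite ler_pdivrMr ?P_gt0 // -ler_pdivrMl // mulrC.
    apply: (le_trans (ltW lt_b)); rewrite ler_nat.
    by apply: ltnW (leq_trans (ltnSn b) (ltnW (ltn_expl _ _))); rewrite p_odd; lia.
  have /RleP := is_lim_seq_incr_compare _ _ lim_e incr s.
  by have := hk_term_ge s0; move: le_eps; lra.
- apply/RleP; apply: (is_lim_seq_le hk_term (fun=> _) e _ _ lim_e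
    (is_lim_seq_const _)) => s.
  exact/RleP/hk_term_le.
Qed.

End HilbertKunz.

Lemma natpowE m s : Nat.pow m s = (m ^ s)%N.
Proof. by elim: s => // s IH; rewrite expnS -IH. Qed.

Local Close Scope ring_scope.

From mathcomp Require Import all_boot all_algebra.
From mathcomp Require Import mpoly.
From Stdlib Require Import Reals.
From Coquelicot Require Import Coquelicot.

Theorem theorem1p1 (n p : nat) (k : fieldType) :
  (3 <= n)%nat -> prime p -> odd p ->
  (~~ odd n -> (n - 2 <= p)%nat) -> (odd n -> (2 * n - 4 <= p)%nat) ->
  perfect_of_char k p ->
  exists (len : nat -> nat) (e : R),
    (forall s : nat,
       quot_dim (frob_pow_ideal (sumsq k n.+2) (p ^ s)) (len s)) /\
    is_lim_seq (fun s : nat => (INR (len s) / INR (p ^ s) ^ (n + 1))%R) e /\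
    (1 + m_coef (n + 1) <= e)%R /\
    (e <= 1 + m_coef (n + 1) + INR (2 * n - 4) / INR p)%R.
Proof.
move=> n_ge3 p_prime p_odd _ _ [p_char _].
have p_eq : p = (p./2).*2.+1 by rewrite -[LHS]odd_double_half p_odd.
have a_gt0 : is_true (leq 1 p./2) by have := prime_gt1 p_prime; lia.
have [e [lim_e ge_e le_e]] := hk_limit p_char p_eq a_gt0 n_ge3.
exists (fun s => \dim (lker (flat k 2 (expn p s) n.+2))), e.
rewrite addn1; split=> [s|]; first by rewrite natpowE; apply: quot_dim_frob.
split; last by split; apply/RleP; rewrite !RealsE.
apply: is_lim_seq_ext lim_e => s.
by rewrite natpowE /hk_term !RealsE.
Qed.
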